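(* Let $A$ be a perfect ring of prime characteristic $p$ (that is, $A^p=A$), and let $S$ be a Noetherian $F$-finite commutative $A$-algebra. Then for any ideal $J$ of $S$, with $\widehat S^J$ the $J$-adic completion of $S$, the natural map $$\widehat S^J\otimes_S D_A(S)\to D_A(\widehat S^J)$$ is a ring isomorphism.
   Context: For a commutative $A$-algebra $S$: $D^0_A(S)=\mathrm{Hom}_S(S,S)$, and for $n\ge1$, $\delta\in\mathrm{Hom}_A(S,S)$ lies in $D^n_A(S)$ iff $[\delta,s]=\delta\circ s-s\circ\delta\in D^{n-1}_A(S)$ for all $s\in S$; $D_A(S)=\bigcup_nD^n_A(S)$ is a ring under composition. The tensor product uses the left $S$-module structure (post-composition with multiplication). Differential operators are $J$-adically continuous, and each $\delta\in D_A(S)$ extends uniquely to $\widehat\delta\in D_A(\widehat S^J)$; the natural map sends $s\otimes\delta$ to $s\widehat\delta$. A commutative ring $S$ of prime characteristic $p$ is $F$-finite if $F^e_*S$ (the ring $S$ viewed as an $S$-module via $s\mapsto s^{p^e}$) is finitely generated over $S$ for some (equivalently, all) $e\ge1$. *)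

(* Defs.v *)
From HB Require Import structures.
From mathcomp Require Import all_boot all_algebra.
From mathcomp Require Import boolp.
From mathcomp.multinomials Require Import freeg.

Set Implicit Arguments.
Unset Strict Implicit.
Unset Printing Implicit Defensive.

Import GRing.Theory.
Local Open Scope ring_scope.
Local Open Scope quotient_scope.

(* Structures whose carrier may be the zero ring ("pz" rings) are used
   throughout, since completing along the unit ideal gives the zero ring.     *)

(* An ideal of a commutative ring R is a submodule of R over itself, that is,
   an instance of the library structure [submodClosed R^o].                   *)
Definition fin_gen_ideal (R : comPzRingType) (I : submodClosed R^o) : Prop :=
  exists (n : nat) (g : 'I_n -> R),
    forall x : R, x \in I <-> exists c : 'I_n -> R, x = \sum_i c i * g i.

Definition noetherian (R : comPzRingType) : Prop :=
  forall I : submodClosed R^o, fin_gen_ideal I.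

(* [F^e_* R] is finitely generated over R for some e >= 1: the scalar c acts on
   [F^e_* R] = R as multiplication by [c ^+ (p ^ e)].                         *)
Definition F_finite (p : nat) (R : comPzRingType) : Prop :=
  exists (e n : nat) (g : 'I_n -> R), (0 < e)%N /\
    forall x : R, exists c : 'I_n -> R, x = \sum_i c i ^+ (p ^ e) * g i.

Section AdicCompletion.
Variables (S : comPzRingType) (J : submodClosed S^o).

Fixpoint ideal_pow (n : nat) : {pred S} :=
  if n is m.+1 then
    fun x : S => `[< exists2 r : seq (S * S),
      {in r, forall ab, ab.1 \in J /\ ab.2 \in ideal_pow m} &
      x = \sum_(ab <- r) ab.1 * ab.2 >]
  else fun _ => true.
Arguments ideal_pow : simpl never.

(* J^(n+1) = J * J^n: finite sums of products. *)
Lemma ideal_powSP n x :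
  (x \in ideal_pow n.+1) <-> (exists2 r : seq (S * S),
      {in r, forall ab, ab.1 \in J /\ ab.2 \in ideal_pow n} &
      x = \sum_(ab <- r) ab.1 * ab.2).
Proof. by split => [/asboolP|H]; last exact/asboolP. Qed.

Lemma idealM_J a x : x \in J -> a * x \in J.
Proof. exact: (@rpredZ S S^o J a x). Qed.

Lemma ideal_pow_closed n : zmod_closed (ideal_pow n).
Proof.
case: n => [|n]; first by [].
split; first by apply/ideal_powSP; exists [::]; rewrite ?big_nil.
move=> x y /ideal_powSP[r hr ->] /ideal_powSP[s hs ->]; apply/ideal_powSP.
exists (r ++ [seq (- ab.1, ab.2) | ab <- s]).
  move=> ab; rewrite mem_cat => /orP[/hr //|/mapP[cd /hs [h1 h2] ->]] /=.
  by split=> //; rewrite -mulN1r; apply: idealM_J.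
rewrite big_cat big_map /=; congr (_ + _); rewrite -sumrN.
by apply: eq_bigr => ab _; rewrite mulNr.
Qed.
HB.instance Definition _ n :=
  GRing.isZmodClosed.Build S (ideal_pow n) (ideal_pow_closed n).

Lemma ideal_powM n a x : x \in ideal_pow n -> a * x \in ideal_pow n.
Proof.
case: n => [//|n] /ideal_powSP[r hr ->]; apply/ideal_powSP.
exists [seq (a * ab.1, ab.2) | ab <- r].
  move=> ab /mapP[cd /hr [h1 h2] ->] /=; split=> //; exact: idealM_J.
by rewrite big_map mulr_sumr; apply: eq_bigr => ab _; rewrite mulrA.
Qed.

Lemma ideal_powJM n a x :
  a \in J -> x \in ideal_pow n -> a * x \in ideal_pow n.+1.
Proof.
move=> aJ xn; apply/ideal_powSP; exists [:: (a, x)]; last by rewrite big_seq1.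
by move=> ab; rewrite inE => /eqP ->.
Qed.

Lemma ideal_powS n x : x \in ideal_pow n.+1 -> x \in ideal_pow n.
Proof.
move=> /ideal_powSP[r hr ->]; rewrite big_seq.
by apply: rpred_sum => ab /hr [_ h]; apply: ideal_powM.
Qed.

Lemma ideal_pow_le m n x : (m <= n)%N -> x \in ideal_pow n -> x \in ideal_pow m.
Proof.
by move=> /subnK <-; elim: (n - m)%N => [//|k IH] /ideal_powS /IH.
Qed.

(* The ring S / J^n.  The library only provides the ring structure on the
   quotient by a proper ideal, so it is built here on the additive quotient.  *)
Definition residue (n : nat) := Quotient.quot (ideal_pow n).
HB.instance Definition _ n := GRing.Zmodule.on (residue n).
HB.instance Definition _ n := Quotient.on (residue n).

Definition residue_of n (x : S) : residue n := \pi_(residue n) x.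

Lemma residue_eqP n x y :
  (residue_of n x = residue_of n y) <-> (x - y \in ideal_pow n).
Proof.
have E := Quotient.idealrBE (ideal_pow n) x y.
by rewrite E; split=> [h|/eqP //]; apply/eqP.
Qed.

Lemma residue_ofK n (c : residue n) : residue_of n (repr c) = c.
Proof. exact: reprK. Qed.

Lemma residue_of_is_zmod_morphism n : zmod_morphism (residue_of n).
Proof. by move=> x y; rewrite /residue_of !piE. Qed.

Definition residue_mul n (c d : residue n) : residue n :=
  residue_of n (repr c * repr d).

Lemma residue_ofM n x y :
  residue_of n (x * y) = residue_mul (residue_of n x) (residue_of n y).
Proof.
apply/residue_eqP.
set x' := repr _; set y' := repr _.
have hx : x - x' \in ideal_pow n by apply/residue_eqP; rewrite residue_ofK.
have hy : y - y' \in ideal_pow n by apply/residue_eqP; rewrite residue_ofK.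
have -> : x * y - x' * y' = y * (x - x') + x' * (y - y').
  by rewrite !mulrBr addrA [y * x]mulrC [y * x']mulrC subrK.
by rewrite rpredD // ideal_powM.
Qed.

Lemma residue_mulA n : associative (@residue_mul n).
Proof.
move=> x y z; rewrite -[x]residue_ofK -[y]residue_ofK -[z]residue_ofK.
by rewrite -!residue_ofM mulrA.
Qed.
Lemma residue_mulC n : commutative (@residue_mul n).
Proof.
move=> x y; rewrite -[x]residue_ofK -[y]residue_ofK.
by rewrite -!residue_ofM mulrC.
Qed.
Lemma residue_mul1 n : left_id (residue_of n 1) (@residue_mul n).
Proof. by move=> x; rewrite -[x]residue_ofK -!residue_ofM mul1r. Qed.
Lemma residue_mulDl n : left_distributive (@residue_mul n) +%R.
Proof.
have aD u v : residue_of n (u + v) = residue_of n u + residue_of n v.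
  by rewrite -[v in LHS]opprK residue_of_is_zmod_morphism
     -[- v]sub0r residue_of_is_zmod_morphism
     -[residue_of n 0](_ : 0 = _) ?sub0r ?opprK //;
     rewrite -(subrr (0 : S)) residue_of_is_zmod_morphism subrr.
move=> x y z; rewrite -[x]residue_ofK -[y]residue_ofK -[z]residue_ofK.
by rewrite -aD -!residue_ofM mulrDl aD.
Qed.
HB.instance Definition _ n := GRing.Zmodule_isComPzRing.Build (residue n)
  (@residue_mulA n) (@residue_mulC n) (@residue_mul1 n) (@residue_mulDl n).

HB.instance Definition _ n := GRing.isZmodMorphism.Build S (residue n)
  (residue_of n) (residue_of_is_zmod_morphism n).
Lemma residue_of_is_monoid_morphism n : monoid_morphism (residue_of n).
Proof. by split=> // x y; rewrite residue_ofM. Qed.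
HB.instance Definition _ n := GRing.isMonoidMorphism.Build S (residue n)
  (residue_of n) (residue_of_is_monoid_morphism n).

Definition residue_trans n (c : residue n.+1) : residue n :=
  residue_of n (repr c).

Lemma residue_transE n x : residue_trans (residue_of n.+1 x) = residue_of n x.
Proof. by apply/residue_eqP/ideal_powS/residue_eqP; rewrite residue_ofK. Qed.

(* The inverse limit of the rings S / J^n. *)
Record completion := Completion {
  coord :> forall n, residue n;
  coord_trans : forall n, residue_trans (coord n.+1) = coord n }.

Lemma completionP (x y : completion) : (forall n, x n = y n) -> x = y.
Proof.
case: x y => [x hx] [y hy] /= exy.
have e : x = y by apply: functional_extensionality_dep.
by case: y / e hy exy => hy _; rewrite (Prop_irrelevance hx hy).
Qed.

HB.instance Definition _ := gen_eqMixin completion.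
HB.instance Definition _ := gen_choiceMixin completion.

Lemma residue_trans_is_zmod_morphism n : zmod_morphism (@residue_trans n).
Proof.
move=> x y; rewrite -[x]residue_ofK -[y]residue_ofK.
by rewrite -rmorphB !residue_transE rmorphB.
Qed.
HB.instance Definition _ n := GRing.isZmodMorphism.Build (residue n.+1)
  (residue n) (@residue_trans n) (@residue_trans_is_zmod_morphism n).
Lemma residue_trans_is_monoid_morphism n : monoid_morphism (@residue_trans n).
Proof.
split=> [|x y]; first by rewrite -[1](rmorph1 (residue_of n.+1)) residue_transE.
rewrite -[x]residue_ofK -[y]residue_ofK.
by rewrite -rmorphM !residue_transE rmorphM.
Qed.
HB.instance Definition _ n := GRing.isMonoidMorphism.Build (residue n.+1)
  (residue n) (@residue_trans n) (@residue_trans_is_monoid_morphism n).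

Program Definition completion_zero := @Completion (fun n => 0) _.
Next Obligation. by rewrite rmorph0. Qed.
Program Definition completion_one := @Completion (fun n => 1) _.
Next Obligation. by rewrite rmorph1. Qed.
Program Definition completion_opp (x : completion) :=
  @Completion (fun n => - x n) _.
Next Obligation. by rewrite rmorphN /= coord_trans. Qed.
Program Definition completion_add (x y : completion) :=
  @Completion (fun n => x n + y n) _.
Next Obligation. by rewrite rmorphD /= !coord_trans. Qed.
Program Definition completion_mul (x y : completion) :=
  @Completion (fun n => x n * y n) _.
Next Obligation. by rewrite rmorphM /= !coord_trans. Qed.

Fact completion_addA : associative completion_add.
Proof. by move=> x y z; apply: completionP => n /=; rewrite addrA. Qed.
Fact completion_addC : commutative completion_add.
Proof. by move=> x y; apply: completionP => n /=; rewrite addrC. Qed.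
Fact completion_add0 : left_id completion_zero completion_add.
Proof. by move=> x; apply: completionP => n /=; rewrite add0r. Qed.
Fact completion_addN : left_inverse completion_zero completion_opp completion_add.
Proof. by move=> x; apply: completionP => n /=; rewrite addNr. Qed.
HB.instance Definition _ := GRing.isZmodule.Build completion
  completion_addA completion_addC completion_add0 completion_addN.

Fact completion_mulA : associative completion_mul.
Proof. by move=> x y z; apply: completionP => n /=; rewrite mulrA. Qed.
Fact completion_mulC : commutative completion_mul.
Proof. by move=> x y; apply: completionP => n /=; rewrite mulrC. Qed.
Fact completion_mul1 : left_id completion_one completion_mul.
Proof. by move=> x; apply: completionP => n /=; rewrite mul1r. Qed.
Fact completion_mulDl : left_distributive completion_mul +%R.
Proof. by move=> x y z; apply: completionP => n /=; rewrite mulrDl. Qed.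
HB.instance Definition _ := GRing.Zmodule_isComPzRing.Build completion
  completion_mulA completion_mulC completion_mul1 completion_mulDl.

Definition completion_of (s : S) : completion :=
  @Completion (fun n => residue_of n s) (fun n => residue_transE n s).

Fact completion_of_is_zmod_morphism : zmod_morphism completion_of.
Proof. by move=> x y; apply: completionP => n /=; rewrite rmorphB. Qed.
HB.instance Definition _ := GRing.isZmodMorphism.Build S completion
  completion_of completion_of_is_zmod_morphism.
Fact completion_of_is_monoid_morphism : monoid_morphism completion_of.
Proof.
by split=> [|x y]; apply: completionP => n /=; rewrite ?rmorph1 ?rmorphM.
Qed.
HB.instance Definition _ := GRing.isMonoidMorphism.Build S completion
  completion_of completion_of_is_monoid_morphism.

Definition completion_scale (s : S) (x : completion) := completion_of s * x.
Fact completion_scaleA a b x :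
  completion_scale a (completion_scale b x) = completion_scale (a * b) x.
Proof. by rewrite /completion_scale rmorphM mulrA. Qed.
Fact completion_scale1 : left_id 1 completion_scale.
Proof. by move=> x; rewrite /completion_scale rmorph1 mul1r. Qed.
Fact completion_scaleDr : right_distributive completion_scale +%R.
Proof. by move=> a x y; rewrite /completion_scale mulrDr. Qed.
Fact completion_scaleDl x : {morph completion_scale^~ x : a b / a + b}.
Proof. by move=> a b; rewrite /completion_scale rmorphD mulrDl. Qed.
HB.instance Definition _ := GRing.Zmodule_isLmodule.Build S completion
  completion_scaleA completion_scale1 completion_scaleDr completion_scaleDl.

Lemma completion_scaleE (s : S) (x : completion) :
  s *: x = completion_of s * x.
Proof. by []. Qed.

Lemma coord_repr (x : completion) m n s :
  (m <= n)%N -> residue_of n s = x n -> residue_of m s = x m.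
Proof.
move=> /subnK <-; elim: (n - m)%N => [//|k IH] h; apply: IH.
by rewrite -coord_trans -h residue_transE.
Qed.

(* J^n M, for an S-module M. *)
Definition ideal_pow_smul (M : lmodType S) (n : nat) (x : M) : Prop :=
  exists2 r : seq (S * M),
    {in r, forall am, am.1 \in ideal_pow n} & x = \sum_(am <- r) am.1 *: am.2.

End AdicCompletion.

Arguments ideal_pow {S} J n : simpl never.
Arguments residue_of {S J} n x.
Arguments completion_of {S J} s.

Section DifferentialOperators.
Variables (A S : comPzRingType) (phi : {rmorphism A -> S}).

(* S is an A-algebra through phi. *)
Definition Alinear (d : S -> S) : Prop :=
  zmod_morphism d /\ forall a x, d (phi a * x) = phi a * d x.

Fixpoint diffop_le (n : nat) (d : S -> S) : Prop :=
  if n is m.+1 then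
    Alinear d /\ forall s, diffop_le m (fun x => d (s * x) - s * d x)
  else zmod_morphism d /\ forall s x, d (s * x) = s * d x.

(* D_A(S), a ring under composition and an S-module by post-composition with
   multiplications. *)
Record diffop := Diffop {
  diffop_fun :> S -> S;
  diffop_proof : exists n, diffop_le n diffop_fun }.

Lemma diffopP (d e : diffop) : (forall x, d x = e x) -> d = e.
Proof.
case: d e => [d hd] [e he] /= exy.
have E : d = e by apply/funext.
by case: e / E he exy => he _; rewrite (Prop_irrelevance hd he).
Qed.

HB.instance Definition _ := gen_eqMixin diffop.
HB.instance Definition _ := gen_choiceMixin diffop.

Lemma eq_diffop_le n d e : d =1 e -> diffop_le n d -> diffop_le n e.
Proof. by move=> /funext ->. Qed.

Lemma diffop_le_Alinear n d : diffop_le n d -> Alinear d.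
Proof. by case: n => [|n] /= [h1 h2] //; split=> //. Qed.

Lemma diffop_leS n d : diffop_le n d -> diffop_le n.+1 d.
Proof.
elim: n d => [|n IH] d /= [h1 h2].
  split=> //.
  by move=> s; split=> [x y|t x]; rewrite ?h2 !subrr ?subr0 ?mulr0.
by split=> // s; apply: (IH _ (h2 s)).
Qed.

Lemma diffop_le_mono m n d : (m <= n)%N -> diffop_le m d -> diffop_le n d.
Proof.
by move=> /subnK <-; elim: (n - m)%N => [//|k IH] /IH; apply: diffop_leS.
Qed.

Lemma diffop_leB n d e :
  diffop_le n d -> diffop_le n e -> diffop_le n (fun x => d x - e x).
Proof.
have aux (f g : S -> S) : zmod_morphism f -> zmod_morphism g ->
    zmod_morphism (fun x => f x - g x).
  by move=> h1 h2 x y; rewrite h1 h2 !opprD !opprK addrACA.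
elim: n d e => [|n IH] d e /= [h1 h2] [h3 h4].
  by split=> [|s x]; [apply: aux | rewrite h2 h4 mulrBr].
split; first split.
- by apply: aux; [case: h1 | case: h3].
- by move=> a x; case: h1 => _ ->; case: h3 => _ ->; rewrite mulrBr.
move=> s; apply: eq_diffop_le (IH _ _ (h2 s) (h4 s)) => x.
by rewrite mulrBr !opprD !opprK addrACA.
Qed.

Lemma diffop_le0 n : diffop_le n (fun _ => 0).
Proof.
apply: (@diffop_le_mono 0) => //.
by split=> [x y|s x]; rewrite ?subrr ?mulr0.
Qed.

Lemma diffop_le_id : diffop_le 0 (fun x => x).
Proof. by split. Qed.

Lemma diffop_leN n d : diffop_le n d -> diffop_le n (fun x => - d x).
Proof.
by move=> h; apply: eq_diffop_le (diffop_leB (diffop_le0 n) h) => x; rewrite sub0r.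
Qed.

Lemma diffop_leD n d e :
  diffop_le n d -> diffop_le n e -> diffop_le n (fun x => d x + e x).
Proof.
move=> h1 h2; apply: eq_diffop_le (diffop_leB h1 (diffop_leN h2)) => x.
by rewrite opprK.
Qed.

Lemma diffop_leZ n a d : diffop_le n d -> diffop_le n (fun x => a * d x).
Proof.
elim: n d => [|n IH] d /= [h1 h2].
  by split=> [x y|s x]; rewrite ?h1 ?mulrBr // h2 mulrCA.
split; first split.
- by move=> x y; case: h1 => -> _; rewrite mulrBr.
- by move=> b x; case: h1 => _ ->; rewrite mulrCA.
move=> s; apply: eq_diffop_le (IH _ (h2 s)) => x.
by rewrite mulrBr [a * (s * _)]mulrCA.
Qed.

Lemma zmod_morphism_comp (f g : S -> S) :
  zmod_morphism f -> zmod_morphism g -> zmod_morphism (fun x => f (g x)).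
Proof. by move=> h1 h2 x y; rewrite h2 h1. Qed.

Lemma diffop_le_comp m n d e :
  diffop_le m d -> diffop_le n e -> diffop_le (m + n) (fun x => d (e x)).
Proof.
move: {2}(m + n)%N (leqnn (m + n)) => N.
elim: N m n d e => [|N IH] m n d e hN hd he.
  move: hN hd he; rewrite leqn0 addn_eq0 => /andP[/eqP -> /eqP ->] /= [h1 h2] [h3 h4].
  by split=> [|s x]; [apply: zmod_morphism_comp | rewrite h4 h2].
have [d1 d2] := diffop_le_Alinear hd; have [e1 e2] := diffop_le_Alinear he.
have lin : Alinear (fun x => d (e x)).
  by split=> [|a x]; [apply: zmod_morphism_comp | rewrite e2 d2].
have E s x : d (e (s * x)) - s * d (e x) =
    (d (e (s * x) - s * e x)) + (d (s * e x) - s * d (e x)).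
  by rewrite d1 addrA subrK.
case: m hN hd => [|m] hN hd; case: n hN he => [|n] hN he.
- by move: hd he => /= [h1 h2] [h3 h4]; split=> [|s x]; rewrite ?h4 ?h2 //; case: lin.
- rewrite add0n /=; split=> // s; rewrite add0n in hN.
  apply: (@eq_diffop_le _ (fun x => d (e (s * x) - s * e x))) => [x|].
    by rewrite E hd.2 subrr addr0.
  by apply: (IH 0 n) => //; case: he => _ /(_ s).
- rewrite addn0 /=; split=> // s; rewrite addn0 in hN.
  apply: (@eq_diffop_le _ (fun x => d (s * e x) - s * d (e x))) => [x|].
    by rewrite he.2.
  rewrite -[m in diffop_le m _]addn0.
  by apply: (IH m 0 (fun y => d (s * y) - s * d y)) => //; rewrite ?addn0 //;
     case: hd => _ /(_ s).
- rewrite addSn /=; split=> // s.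
  apply: (@eq_diffop_le _ (fun x => d (e (s * x) - s * e x) +
                                    (d (s * e x) - s * d (e x)))) => [x|].
    by rewrite E.
  apply: diffop_leD.
    rewrite addnS -addSn; apply: (IH m.+1 n) => //; last by case: he => _ /(_ s).
    by move: hN; rewrite addnS.
  by apply: (IH m n.+1 (fun y => d (s * y) - s * d y)) => //; case: hd => _ /(_ s).
Qed.

Lemma diffop_is_zmod_morphism (d : diffop) : zmod_morphism d.
Proof. by have [n /diffop_le_Alinear []] := diffop_proof d. Qed.
HB.instance Definition _ (d : diffop) := GRing.isZmodMorphism.Build S S
  (diffop_fun d) (diffop_is_zmod_morphism d).

Lemma diffop_common (d e : diffop) : exists n, diffop_le n d /\ diffop_le n e.
Proof.
case: d e => [d [m hd]] [e [n he]]; exists (maxn m n).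
by split; apply: diffop_le_mono; [apply: leq_maxl|exact: hd|apply: leq_maxr|].
Qed.

Program Definition diffop_zero := @Diffop (fun _ => 0) _.
Next Obligation. by exists 0; apply: diffop_le0. Qed.
Program Definition diffop_one := @Diffop (fun x => x) _.
Next Obligation. by exists 0; apply: diffop_le_id. Qed.
Program Definition diffop_opp (d : diffop) := @Diffop (fun x => - d x) _.
Next Obligation.
by case: d => d [n hd]; exists n; apply: diffop_leN.
Qed.
Program Definition diffop_add (d e : diffop) := @Diffop (fun x => d x + e x) _.
Next Obligation.
by have [n [hd he]] := diffop_common d e; exists n; apply: diffop_leD.
Qed.
Program Definition diffop_mul (d e : diffop) := @Diffop (fun x => d (e x)) _.
Next Obligation.
by have [n [hd he]] := diffop_common d e; exists (n + n)%N; apply: diffop_le_comp.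
Qed.
Program Definition diffop_scale (s : S) (d : diffop) :=
  @Diffop (fun x => s * d x) _.
Next Obligation.
by case: d => d [n hd]; exists n; apply: diffop_leZ.
Qed.

Fact diffop_addA : associative diffop_add.
Proof. by move=> x y z; apply: diffopP => n /=; rewrite addrA. Qed.
Fact diffop_addC : commutative diffop_add.
Proof. by move=> x y; apply: diffopP => n /=; rewrite addrC. Qed.
Fact diffop_add0 : left_id diffop_zero diffop_add.
Proof. by move=> x; apply: diffopP => n /=; rewrite add0r. Qed.
Fact diffop_addN : left_inverse diffop_zero diffop_opp diffop_add.
Proof. by move=> x; apply: diffopP => n /=; rewrite addNr. Qed.
HB.instance Definition _ := GRing.isZmodule.Build diffop
  diffop_addA diffop_addC diffop_add0 diffop_addN.

Fact diffop_mulA : associative diffop_mul.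
Proof. by move=> x y z; apply: diffopP. Qed.
Fact diffop_mul1 : left_id diffop_one diffop_mul.
Proof. by move=> x; apply: diffopP. Qed.
Fact diffop_mulr1 : right_id diffop_one diffop_mul.
Proof. by move=> x; apply: diffopP. Qed.
Fact diffop_mulDl : left_distributive diffop_mul +%R.
Proof. by move=> x y z; apply: diffopP. Qed.
Fact diffop_mulDr : right_distributive diffop_mul +%R.
Proof. by move=> x y z; apply: diffopP => n /=; rewrite raddfD. Qed.
HB.instance Definition _ := GRing.Zmodule_isPzRing.Build diffop
  diffop_mulA diffop_mul1 diffop_mulr1 diffop_mulDl diffop_mulDr.

Fact diffop_scaleA a b d :
  diffop_scale a (diffop_scale b d) = diffop_scale (a * b) d.
Proof. by apply: diffopP => x /=; rewrite mulrA. Qed.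
Fact diffop_scale1 : left_id 1 diffop_scale.
Proof. by move=> d; apply: diffopP => x /=; rewrite mul1r. Qed.
Fact diffop_scaleDr : right_distributive diffop_scale +%R.
Proof. by move=> a d e; apply: diffopP => x /=; rewrite mulrDr. Qed.
Fact diffop_scaleDl d : {morph diffop_scale^~ d : a b / a + b}.
Proof. by move=> a b; apply: diffopP => x /=; rewrite mulrDl. Qed.
HB.instance Definition _ := GRing.Zmodule_isLmodule.Build S diffop
  diffop_scaleA diffop_scale1 diffop_scaleDr diffop_scaleDl.

End DifferentialOperators.

(* M (x)_S N: the free abelian group on M * N modulo the subgroup generated by
   the bilinearity relations.                                                 *)
Section TensorProduct.
Variables (S : comPzRingType) (M N : lmodType S).

Definition free_pairs := {freeg (M * N)%type}.
HB.instance Definition _ := GRing.Zmodule.on free_pairs.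
Definition pair_gen (m : M) (n : N) : free_pairs := << (m, n) >>.

Inductive tensor_rel : free_pairs -> Prop :=
| tensor_rel_addl m m' n :
    tensor_rel (pair_gen (m + m') n - pair_gen m n - pair_gen m' n)
| tensor_rel_addr m n n' :
    tensor_rel (pair_gen m (n + n') - pair_gen m n - pair_gen m n')
| tensor_rel_scale a m n :
    tensor_rel (pair_gen (a *: m) n - pair_gen m (a *: n))
| tensor_rel_zero : tensor_rel 0
| tensor_rel_sub x y : tensor_rel x -> tensor_rel y -> tensor_rel (x - y).

Definition tensor_relb : {pred free_pairs} :=
  fun x => `[< tensor_rel x >].

Fact tensor_relb_closed : zmod_closed tensor_relb.
Proof.
split=> [|x y /asboolP hx /asboolP hy]; apply/asboolP.
  exact: tensor_rel_zero.
exact: tensor_rel_sub.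
Qed.
HB.instance Definition _ := GRing.isZmodClosed.Build free_pairs
  tensor_relb tensor_relb_closed.

Definition tensor := Quotient.quot tensor_relb.
HB.instance Definition _ := GRing.Zmodule.on tensor.
HB.instance Definition _ := Quotient.on tensor.

Definition tens (m : M) (n : N) : tensor := \pi_tensor (pair_gen m n).

Definition tensor_pi (x : free_pairs) : tensor := \pi_tensor x.
Fact tensor_pi_is_zmod_morphism : zmod_morphism tensor_pi.
Proof. by move=> x y; rewrite /tensor_pi !piE. Qed.
HB.instance Definition _ := GRing.isZmodMorphism.Build free_pairs tensor
  tensor_pi tensor_pi_is_zmod_morphism.

Lemma tensor_pi_eqP x y : (tensor_pi x = tensor_pi y) <-> tensor_rel (x - y).
Proof.
have E : (x - y \in tensor_relb) = (tensor_pi x == tensor_pi y).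
  exact: Quotient.idealrBE.
split=> [h|h].
  by have /asboolP : x - y \in tensor_relb by rewrite E h.
by apply/eqP; rewrite -E; apply/asboolP.
Qed.

Lemma tensDl m m' n : tens (m + m') n = tens m n + tens m' n.
Proof.
rewrite -[RHS](raddfD tensor_pi); apply/tensor_pi_eqP.
by rewrite opprD addrA; apply: tensor_rel_addl.
Qed.

Lemma tensDr m n n' : tens m (n + n') = tens m n + tens m n'.
Proof.
rewrite -[RHS](raddfD tensor_pi); apply/tensor_pi_eqP.
by rewrite opprD addrA; apply: tensor_rel_addr.
Qed.

Lemma tensZ a m n : tens (a *: m) n = tens m (a *: n).
Proof. by apply/tensor_pi_eqP; apply: tensor_rel_scale. Qed.

Lemma tensor_ind (P : tensor -> Prop) :
  (forall m n, P (tens m n)) -> (forall x y, P x -> P y -> P (x - y)) ->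
  forall x, P x.
Proof.
move=> Ptens PB.
have P0 : P 0 by rewrite -(subrr (tens 0 0)); apply: PB.
have PN x : P x -> P (- x) by move=> Px; rewrite -[- x]sub0r; apply: PB.
have PD x y : P x -> P y -> P (x + y).
  by move=> Px Py; rewrite -[y]opprK; apply: PB => //; apply: PN.
move=> x; rewrite -[x]reprK -[\pi _]/(tensor_pi _) -[repr x]freeg_sumE.
rewrite raddf_sum; elim/big_ind: _ => // -[m n] _.
set k := coeff _ _; rewrite -[k]intz -freegU_mulz raddfMz.
have Pn i : P (tensor_pi (pair_gen m n) *+ i).
  elim: i => [//|i IH]; rewrite mulrS; apply: PD => //; exact: Ptens.
by case: k => i; [apply: Pn | apply: PN; apply: Pn].
Qed.

Section Lift.
Variables (G : zmodType) (f : M -> N -> G).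

Record balanced : Prop := Balanced {
  balancedDl : forall m m' n, f (m + m') n = f m n + f m' n;
  balancedDr : forall m n n', f m (n + n') = f m n + f m n';
  balancedZ : forall a m n, f (a *: m) n = f m (a *: n) }.

Definition free_lift : free_pairs -> G :=
  fglift (fun mn => f mn.1 mn.2 : zmodule G).

Lemma free_liftB : zmod_morphism free_lift.
Proof. exact: (@lift_is_additive int _ (zmodule G)). Qed.

HB.instance Definition _ := GRing.isZmodMorphism.Build free_pairs G free_lift
  free_liftB.

Lemma free_liftU m n : free_lift (pair_gen m n) = f m n.
Proof. by rewrite /free_lift liftU scale1r. Qed.

(* Meaningful when f is balanced; see [tensor_liftE]. *)
Definition tensor_lift (x : tensor) : G := free_lift (repr x).

Hypothesis fP : balanced.

Lemma free_lift_rel x : tensor_rel x -> free_lift x = 0.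
Proof.
elim=> [m m' n|m n n'|a m n||{}x y _ hx _ hy].
- by rewrite !raddfB /= !free_liftU (balancedDl fP) addrAC addrK subrr.
- by rewrite !raddfB /= !free_liftU (balancedDr fP) addrAC addrK subrr.
- by rewrite !raddfB /= !free_liftU (balancedZ fP) subrr.
- by rewrite raddf0.
- by rewrite raddfB /= hx hy subrr.
Qed.

Lemma tensor_lift_pi x : tensor_lift (tensor_pi x) = free_lift x.
Proof.
apply/eqP; rewrite -subr_eq0 -raddfB /= free_lift_rel //.
by apply/tensor_pi_eqP; rewrite /tensor_pi reprK.
Qed.

Lemma tensor_liftE m n : tensor_lift (tens m n) = f m n.
Proof. by rewrite [LHS]tensor_lift_pi free_liftU. Qed.

Lemma tensor_lift_is_zmod_morphism : zmod_morphism tensor_lift.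
Proof.
move=> x y; rewrite -[x]reprK -[y]reprK -!/(tensor_pi _).
by rewrite -(raddfB tensor_pi) !tensor_lift_pi raddfB.
Qed.

End Lift.

Lemma eq_zmod_morphism_tensor (G : zmodType) (f g : tensor -> G) :
  zmod_morphism f -> zmod_morphism g ->
  (forall m n, f (tens m n) = g (tens m n)) -> f =1 g.
Proof.
by move=> fB gB fg; apply: tensor_ind => // x y hx hy; rewrite fB gB hx hy.
Qed.

Definition tensor_scale (a : S) : tensor -> tensor :=
  tensor_lift (fun m n => tens (a *: m) n).

Fact tensor_scale_balanced a : balanced (fun m n => tens (a *: m) n).
Proof.
split=> [m m' n|m n n'|b m n]; first by rewrite scalerDr tensDl.
  by rewrite tensDr.
by rewrite scalerA mulrC -scalerA tensZ.
Qed.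

Lemma tensor_scaleE a m n : tensor_scale a (tens m n) = tens (a *: m) n.
Proof. exact: (tensor_liftE (tensor_scale_balanced a)). Qed.

Lemma tensor_scaleB a : zmod_morphism (tensor_scale a).
Proof. exact: (tensor_lift_is_zmod_morphism (tensor_scale_balanced a)). Qed.

Fact tensor_scaleA a b x :
  tensor_scale a (tensor_scale b x) = tensor_scale (a * b) x.
Proof.
elim/tensor_ind: x => [m n|x y hx hy]; first by rewrite !tensor_scaleE scalerA.
by rewrite !tensor_scaleB hx hy.
Qed.
Fact tensor_scale1 : left_id 1 tensor_scale.
Proof.
elim/tensor_ind=> [m n|x y hx hy]; first by rewrite tensor_scaleE scale1r.
by rewrite tensor_scaleB hx hy.
Qed.
Fact tensor_scaleDr : right_distributive tensor_scale +%R.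
Proof.
move=> a x y; have B := tensor_scaleB a.
have N0 : tensor_scale a 0 = 0 by move: (B 0 0); rewrite !subrr.
by rewrite -[y in LHS]opprK B -[- y]sub0r B N0 sub0r opprK.
Qed.
Fact tensor_scaleDl x : {morph tensor_scale^~ x : a b / a + b}.
Proof.
move=> a b; elim/tensor_ind: x => [m n|x y hx hy].
  by rewrite !tensor_scaleE scalerDl tensDl.
by rewrite !tensor_scaleB hx hy opprD addrACA.
Qed.
HB.instance Definition _ := GRing.Zmodule_isLmodule.Build S tensor
  tensor_scaleA tensor_scale1 tensor_scaleDr tensor_scaleDl.

End TensorProduct.

Arguments tens {S M N} m n.

Section NaturalMap.
Variables (A S : comPzRingType) (phi : {rmorphism A -> S}).
Variable J : submodClosed S^o.

Local Notation "S^" := (completion J) (at level 0).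

(* S^ is an A-algebra through S. *)
Definition completion_alg : {rmorphism A -> S^} := @completion_of S J \o phi.

Lemma diffop_le_ideal_pow n k (d : S -> S) x :
  diffop_le phi n d -> x \in ideal_pow J (k + n) -> d x \in ideal_pow J k.
Proof.
elim: n k d x => [|n IHn] k d x.
  by case=> _ hd; rewrite addn0 => hx; rewrite -[x]mulr1 hd mulrC ideal_powM.
elim: k x => [//|k IHk] x hd.
rewrite addSn => /ideal_powSP[r hr ->].
have [[dB _] dC] := hd.
have dsum (s : seq (S * S)) :
    d (\sum_(ab <- s) ab.1 * ab.2) = \sum_(ab <- s) d (ab.1 * ab.2).
  have d0 : d 0 = 0 by move: (dB 0 0); rewrite !subrr.
  elim: s => [|ab s IH]; rewrite ?big_nil ?big_cons // -IH.
  by rewrite -[X in _ + X]opprK dB -[- \sum_(j <- s) _]sub0r dB d0 sub0r opprK.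
rewrite dsum big_seq; apply: rpred_sum => -[a b] /hr [/= aJ bJ].
rewrite -[d _](subrK (a * d b)); apply: rpredD.
  by apply: (IHn k.+1 _ _ (dC a)); rewrite addSnnS.
by apply: ideal_powJM => //; apply: IHk.
Qed.

Definition diffop_order (d : diffop phi) : nat := projT1 (cid (diffop_proof d)).

Lemma diffop_orderP (d : diffop phi) : diffop_le phi (diffop_order d) d.
Proof. exact: projT2 (cid (diffop_proof d)). Qed.

(* If d has order <= n, the class of d x modulo J^k only depends on that of x
   modulo J^(k+n).                                                            *)
Definition diffop_ext_coord (d : diffop phi) (x : S^) (k : nat) : residue J k :=
  residue_of k (d (repr (x (k + diffop_order d)%N))).

Lemma diffop_ext_coordE n (d : diffop phi) (x : S^) k s :
  diffop_le phi n d -> residue_of (k + n)%N s = x (k + n)%N ->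
  diffop_ext_coord d x k = residue_of k (d s).
Proof.
move=> hd hs; apply/residue_eqP; rewrite -raddfB.
set m := diffop_order d; set t := repr _.
have ht : residue_of (k + m)%N t = x (k + m)%N by exact: residue_ofK.
have [le_mn|/ltnW le_nm] := leqP m n.
  apply: (diffop_le_ideal_pow (diffop_orderP d)); apply/residue_eqP.
  by rewrite ht (coord_repr _ hs) // leq_add2l.
apply: (diffop_le_ideal_pow hd); apply/residue_eqP.
by rewrite hs (coord_repr _ ht) // leq_add2l.
Qed.

Fact diffop_ext_trans d x k :
  residue_trans (diffop_ext_coord d x k.+1) = diffop_ext_coord d x k.
Proof.
rewrite residue_transE; set t := repr _.
have ht : residue_of (k.+1 + diffop_order d)%N t = x (k.+1 + diffop_order d)%N.
  exact: residue_ofK.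
apply/esym/(diffop_ext_coordE (diffop_orderP d)).
by apply: coord_repr ht; rewrite leq_add2r.
Qed.

Definition diffop_ext_fun (d : diffop phi) (x : S^) : S^ :=
  Completion (diffop_ext_trans d x).

(* D acts on the k-th coordinate as some d of order <= n on S; d depends on k. *)
Definition approximable n (D : S^ -> S^) : Prop :=
  forall k, exists2 d : S -> S, diffop_le phi n d &
    forall (x : S^) s, residue_of (k + n)%N s = x (k + n)%N -> D x k = residue_of k (d s).

Lemma approximable_diffop_le n D :
  approximable n D -> diffop_le completion_alg n D.
Proof.
have lin m E : approximable m E -> Alinear completion_alg E.
  move=> hE; split=> [x y|a x]; apply: completionP => k;
    have [d hd hdE] := hE k; have [dB dA] := diffop_le_Alinear hd.
    rewrite (hdE _ (repr (x (k + m)%N) - repr (y (k + m)%N))) /=; last first.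
      by rewrite rmorphB /= !residue_ofK.
    rewrite dB rmorphB; congr (_ - _); apply/esym/hdE; exact: residue_ofK.
  rewrite (hdE _ (phi a * repr (x (k + m)%N))) /=; last first.
    by rewrite rmorphM /= residue_ofK.
  rewrite dA rmorphM; congr (_ * _); apply/esym/hdE; exact: residue_ofK.
elim: n D => [|n IH] D hD.
  split; first by case: (lin _ _ hD).
  move=> a x; apply: completionP => k; have [d hd hdE] := hD k.
  rewrite addn0 in hdE.
  rewrite (hdE _ (repr (a k) * repr (x k))) /=; last first.
    by rewrite rmorphM /= !residue_ofK.
  rewrite hd.2 rmorphM /= residue_ofK; congr (_ * _); apply/esym/hdE.
  exact: residue_ofK.
split; first exact: lin hD.
move=> a; apply: IH => k; have [d hd hdE] := hD k.
pose s := repr (a (k + n.+1)%N).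
have hs : residue_of (k + n.+1)%N s = a (k + n.+1)%N by exact: residue_ofK.
exists (fun y => d (s * y) - s * d y); first by case: hd => _ /(_ s).
move=> x t ht; pose u := repr (x (k + n.+1)%N).
have hu : residue_of (k + n.+1)%N u = x (k + n.+1)%N by exact: residue_ofK.
have le_nS : (k + n <= k + n.+1)%N by rewrite leq_add2l.
transitivity (residue_of (J := J) k (d (s * u) - s * d u)).
  rewrite rmorphB rmorphM /= -(hdE (a * x) (s * u)); last first.
    by rewrite rmorphM /= hs hu.
  by rewrite -(hdE x u hu) (coord_repr _ hs) // leq_addr.
apply/residue_eqP; have hds : diffop_le phi n (fun y => d (s * y) - s * d y).
  by case: hd => _ /(_ s).
have [B _] := diffop_le_Alinear hds.
rewrite -(B u t); apply: (@diffop_le_ideal_pow n k _ (u - t) hds).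
apply/residue_eqP.
by rewrite ht (coord_repr le_nS hu).
Qed.

Fact diffop_ext_proof d :
  exists n, diffop_le completion_alg n (diffop_ext_fun d).
Proof.
have hd := diffop_orderP d; exists (diffop_order d).
apply: approximable_diffop_le => k; exists d => // x s hs.
exact: (diffop_ext_coordE hd hs).
Qed.

Definition diffop_ext (d : diffop phi) : diffop completion_alg :=
  Diffop (diffop_ext_proof d).

Lemma diffop_ext_of (d : diffop phi) s :
  diffop_ext d (completion_of s) = completion_of (d s).
Proof.
apply: completionP => k.
exact: (diffop_ext_coordE (s := s) (diffop_orderP d)).
Qed.

Definition completed_tensor := tensor S^ (diffop phi).
HB.instance Definition _ := GRing.Lmodule.on completed_tensor.

Definition ctens (u : S^) (d : diffop phi) : completed_tensor := tens u d.

Definition natural_map : completed_tensor -> diffop completion_alg :=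
  tensor_lift (fun (u : S^) (d : diffop phi) => u *: diffop_ext d).

Fact natural_map_balanced :
  balanced (fun (u : S^) (d : diffop phi) => u *: diffop_ext d).
Proof.
split=> [u v d|u d e|a u d].
- by rewrite scalerDl.
- rewrite -scalerDr; congr (_ *: _); apply: diffopP => x.
  apply: completionP => k.
  have [n [hd he]] := diffop_common d e.
  have hs := residue_ofK (x (k + n)%N).
  rewrite /= (diffop_ext_coordE hd hs) (diffop_ext_coordE he hs).
  by rewrite (@diffop_ext_coordE n (d + e) x k _ (diffop_leD hd he) hs) /= rmorphD.
- apply: diffopP => x; apply: completionP => k.
  have hd := diffop_orderP d; have hs := residue_ofK (x (k + diffop_order d)%N).
  rewrite /= (diffop_ext_coordE hd hs) (@diffop_ext_coordE _ (a *: d) x k _ (diffop_leZ a hd) hs).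
  by rewrite /= rmorphM mulrA [residue_of k a * _]mulrC.
Qed.

Lemma natural_mapE u d : natural_map (ctens u d) = u *: diffop_ext d.
Proof. exact: tensor_liftE natural_map_balanced u d. Qed.

HB.instance Definition _ := GRing.isZmodMorphism.Build completed_tensor
  (diffop completion_alg) natural_map
  (tensor_lift_is_zmod_morphism natural_map_balanced).

(* The ring structure on S^ (x)_S D_A(S): it extends those of S^ and D_A(S),
   [u (x) d] is the product of [u (x) 1] and [1 (x) d], and the product
   [(1 (x) d) * (u (x) 1)] is J-adically continuous in u.  For u the image of s
   in S, this product is [1 (x) (d * s)]; continuity extends this to all u.    *)
Record is_tensor_mul
    (mul : completed_tensor -> completed_tensor -> completed_tensor) : Prop := {
  tensor_mulA : associative mul;
  tensor_mul1 : left_id (ctens 1 1) mul;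
  tensor_mulr1 : right_id (ctens 1 1) mul;
  tensor_mulDl : left_distributive mul +%R;
  tensor_mulDr : right_distributive mul +%R;
  tensor_mul_completion u v d : mul (ctens u 1) (ctens v d) = ctens (u * v) d;
  tensor_mul_diffop d e : mul (ctens 1 d) (ctens 1 e) = ctens 1 (d * e);
  tensor_mul_continuous d k : exists m, forall u : S^,
    ideal_pow_smul J m u ->
    ideal_pow_smul J k (mul (ctens 1 d) (ctens u 1)) }.

End NaturalMap.

(* Main.v *)
Require Import Defs.
From HB Require Import structures.
From mathcomp Require Import all_boot all_algebra.
From mathcomp Require Import boolp.

(* Put q = p^e with e large.  An operator of order <= e commutes with q-th
   powers; conversely, if S is spanned over its q-th powers by g_1, ..., g_n and
   A is perfect, every additive q-power linear map is a differential operator.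
   Such a map is determined by its values on the g_i, and these values are the
   solutions in S^n of a finite linear system, whose coefficients are the q-th
   powers of the coordinates of generators of the relations
   sum_i c_i^q g_i = 0.  An operator on the completion is determined by its
   restriction to S, by J-adic continuity, hence also by its values on the g_i,
   which satisfy the same system.  Flatness of the completion over S, in the
   form of the equational criterion, then gives both surjectivity (the values
   are combinations of solutions over S) and injectivity (a vanishing
   combination sum_j u_j d_j(g_i) = 0 comes from relations over S).  The ring
   structure is transported along the bijection; it is the only one since
   (1 (x) d) * (u (x) 1) is prescribed for u in S and J-adically continuous,
   while the intersection of the J^k D(S^) is zero.                           *)

Set Implicit Arguments.
Unset Strict Implicit.
Unset Printing Implicit Defensive.

Import GRing.Theory.
Local Open Scope ring_scope.

(** * Frobenius and iterated commutators *)

Section Frobenius.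
Variables (p : nat) (R : comPzRingType).
Hypotheses (p_prime : prime p) (p0 : p%:R = 0 :> R).

Lemma mulrn_prime_dvd (x : R) m : (p %| m)%N -> x *+ m = 0.
Proof. by case/dvdnP=> k ->; rewrite mulrnA -mulr_natr p0 mulr0. Qed.

Lemma bin_sum_prime (f : nat -> R) :
  \sum_(i < p.+1) f i *+ 'C(p, i) = f 0%N + f p.
Proof.
case: p p_prime mulrn_prime_dvd => [//|q] q_prime q0.
rewrite big_ord_recl big_ord_recr /= bin0 mulr1n /bump leq0n !add1n binn mulr1n.
rewrite big1 ?add0r // => i _; apply/q0/prime_dvd_bin => //.
by rewrite /= ltnS; case: i.
Qed.

Lemma frobeniusD e (x y : R) : (x + y) ^+ (p ^ e) = x ^+ (p ^ e) + y ^+ (p ^ e).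
Proof.
elim: e => [|e IH]; first by rewrite expn0 !expr1.
rewrite expnSr !exprM IH exprDn.
rewrite (bin_sum_prime (fun i => _ ^+ (p - i) * _ ^+ i)).
by rewrite subn0 subnn !expr0 mulr1 mul1r.
Qed.

Lemma frobenius0 e : 0 ^+ (p ^ e) = 0 :> R.
Proof. by rewrite expr0n expn_eq0 eqn0Ngt prime_gt0. Qed.

Lemma frobeniusN e (x : R) : (- x) ^+ (p ^ e) = - x ^+ (p ^ e).
Proof.
by apply/eqP; rewrite -subr_eq0 opprK -frobeniusD addNr frobenius0.
Qed.

Lemma frobeniusB e (x y : R) : (x - y) ^+ (p ^ e) = x ^+ (p ^ e) - y ^+ (p ^ e).
Proof. by rewrite frobeniusD frobeniusN. Qed.

Lemma frobenius_sum e (I : finType) (f : I -> R) :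
  (\sum_i f i) ^+ (p ^ e) = \sum_i f i ^+ (p ^ e).
Proof.
apply: (big_morph (fun x => x ^+ (p ^ e))); [exact: frobeniusD|].
exact: frobenius0.
Qed.

Definition commutator (g : R) (d : R -> R) (x : R) : R := d (g * x) - g * d x.

(** [commutator g] is the difference of two commuting operations on d, composing with multiplication
    by g before and after d, so its powers follow the binomial formula. *)
Lemma iter_commutatorE (g : R) (d : R -> R) n x :
  iter n (commutator g) d x =
  \sum_(i < n.+1) (- g) ^+ i * d (g ^+ (n - i) * x) *+ 'C(n, i).
Proof.
elim: n x => [|n IH] x.
  by rewrite big_ord_recl big_ord0 addr0 /= expr0 !mul1r mulr1n.
rewrite iterS {1}/commutator !IH [in RHS]big_ord_recl.
rewrite bin0 mulr1n expr0 mul1r subn0.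
rewrite [in RHS](eq_bigr (fun i : 'I_n.+1 =>
    (- g) ^+ i.+1 * d (g ^+ (n - i) * x) *+ 'C(n, i.+1) +
    (- g) ^+ i.+1 * d (g ^+ (n - i) * x) *+ 'C(n, i))); last first.
  by move=> i _; rewrite lift0 subSS binS mulrnDr.
rewrite big_split /= addrA; congr (_ + _).
  rewrite big_ord_recl [in RHS]big_ord_recr /= [in RHS]bin_small //.
  rewrite mulr0n addr0.
  rewrite bin0 mulr1n expr0 mul1r subn0 mulrA -exprSr; congr (_ + _).
  apply: eq_bigr => i _; rewrite /bump /= add1n mulrA -exprSr.
  by rewrite subnSK // ltn_ord.
rewrite -mulNr mulr_sumr; apply: eq_bigr => i _.
by rewrite mulrnAr mulrA -exprS.
Qed.

(* In characteristic p, ad(g)^p = ad(g^p) since left and right multiplications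
   by g commute.                                                              *)
Lemma iter_commutator_frobenius e (g : R) :
  iter (p ^ e) (commutator g) =1 commutator (g ^+ (p ^ e)).
Proof.
have step h : iter p (commutator h) = commutator (h ^+ p).
  apply/funext => d; apply/funext => x.
  rewrite iter_commutatorE.
  rewrite (bin_sum_prime (fun i => (- h) ^+ i * d (h ^+ (p - i) * x))).
  rewrite subn0 subnn expr0 expr0 !mul1r /commutator; congr (_ + _).
  by have := frobeniusN 1 h; rewrite expn1 => ->; rewrite mulNr.
elim: e g => [|e IH] g d; first by rewrite expn0 expr1.
by rewrite expnSr iterM step IH -exprM mulnC.
Qed.

End Frobenius.

(** * Differential operators and q-power linear maps *)

Section DiffopFrobenius.
Variables (p : nat) (A R : comPzRingType) (phi : {rmorphism A -> R}).
Hypotheses (p_prime : prime p) (p0 : p%:R = 0 :> R).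

(** For additive d this is R-linearity on F^e_* R. *)
Definition frobenius_linear e (d : R -> R) :=
  forall s x, d (s ^+ (p ^ e) * x) = s ^+ (p ^ e) * d x.

Definition frobenius_span e n (g : 'I_n -> R) :=
  forall x, exists c : 'I_n -> R, x = \sum_i c i ^+ (p ^ e) * g i.

(* If [d, t] commutes with t, then [d, t^p] = p t^(p-1) [d, t] = 0. *)
Lemma diffop_le_frobenius n d : diffop_le phi n d -> frobenius_linear n d.
Proof.
elim: n d => [|n IH] d.
  by case=> _ hd s x; rewrite expn0 expr1 hd.
case=> _ hd s x; rewrite expnSr exprM; set t := s ^+ (p ^ n).
have ht y : d (t * y) - t * d y = commutator t d y by [].
have comm y : commutator t d (t * y) = t * commutator t d y.
  exact: (IH _ (hd t) s y).
have pow m y : d (t ^+ m * y) = t ^+ m * d y + t ^+ m.-1 * commutator t d y *+ m.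
  elim: m y => [|m IHm] y; first by rewrite expr0 !mul1r addr0.
  rewrite exprSr -mulrA IHm comm -[d (t * y)](subrK (t * d y)) ht mulrDr !mulrA.
  case: m IHm => [|m] IHm.
    by rewrite !expr0 !mul1r !mulr0n addr0 mulr1n addrC.
  rewrite -!exprSr [X in X + _ = _]addrC -addrA; congr (_ + _).
by rewrite pow [X in _ + X](mulrn_prime_dvd p0) // addr0.
Qed.

Lemma frobenius_linear_le m n d :
  (m <= n)%N -> frobenius_linear m d -> frobenius_linear n d.
Proof.
move=> /subnK <- hd s x.
by rewrite expnD exprM; apply: hd.
Qed.

Lemma commutator_zmod_morphism g d :
  zmod_morphism d -> zmod_morphism (commutator g d : R -> R).
Proof.
by move=> dB x y; rewrite /commutator mulrBr !dB mulrBr !opprD !opprK addrACA.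
Qed.

Lemma commutator_frobenius_linear e g d :
  frobenius_linear e d -> frobenius_linear e (commutator g d).
Proof.
by move=> hd s x; rewrite /commutator mulrCA !hd [g * (_ * _)]mulrCA mulrBr.
Qed.

Lemma iter_commutatorC m (g h : R) d :
  iter m (commutator h) (commutator g d) = commutator g (iter m (commutator h) d).
Proof.
elim: m => [//|m IH]; rewrite !iterS IH; apply/funext => x.
rewrite /commutator !mulrBr [h * (g * x)]mulrCA [h * (g * _)]mulrCA.
by rewrite !opprD !opprK !addrA; congr (_ + _); rewrite addrAC.
Qed.

Lemma diffop_le_sum m (I : finType) (d : I -> R -> R) :
  (forall i, diffop_le phi m (d i)) -> diffop_le phi m (fun x => \sum_i d i x).
Proof.
move=> hd; elim: (index_enum I) => [|i r IH].
  by apply: eq_diffop_le (diffop_le0 phi m) => x; rewrite big_nil.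
by apply: eq_diffop_le (diffop_leD (hd i) IH) => x; rewrite big_cons.
Qed.

Hypothesis perfectA : forall a : A, exists b : A, a = b ^+ p.

Lemma perfect_root e (a : A) : exists b, a = b ^+ (p ^ e).
Proof.
elim: e a => [|e IH] a; first by exists a; rewrite expn0 expr1.
have [b ->] := IH a; have [c ->] := perfectA b.
by exists c; rewrite -exprM expnS.
Qed.

Variables (e n : nat) (g : 'I_n -> R).
Hypothesis gP : frobenius_span e g.

(** Write s = sum_i c_i^q g_i with q = p^e: the scalars c_i^q commute with d, so only the
    commutators with the g_i remain. *)
Lemma commutator_span (d : R -> R) s :
  zmod_morphism d -> frobenius_linear e d ->
  exists c : 'I_n -> R, forall x,
    d (s * x) - s * d x = \sum_i c i * commutator (g i) d x.
Proof.
move=> dB hd; have [c ->] := gP s.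
exists (fun i => c i ^+ (p ^ e)) => x.
pose d' := GRing.isZmodMorphism.Build R R d dB.
pose D : {additive R -> R} := HB.pack d d'.
rewrite !mulr_suml -[d _]/(D _) raddf_sum -sumrB; apply: eq_bigr => i _ /=.
by rewrite /commutator -!mulrA hd mulrBr.
Qed.

(** Induction on N, a bound for the sum of the nilpotency exponents a_i. The operations ad(g_i)
    commute, so passing from d to [d, g_i] lowers a_i by one and keeps the other exponents; an
    exponent 0 forces d = 0. *)
Lemma iter_commutator_diffop N (a : 'I_n -> nat) d :
    (\sum_i a i <= N)%N -> zmod_morphism d -> frobenius_linear e d ->
    (forall i x, iter (a i) (commutator (g i)) d x = 0) ->
  diffop_le phi N d.
Proof.
(* Perfectness of A makes phi b a q-th power, so linearity over q-th powers gives A-linearity. *)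
have lin d' : zmod_morphism d' -> frobenius_linear e d' -> Alinear phi d'.
  move=> dB hd; split=> // b x; have [b' ->] := perfect_root e b.
  by rewrite rmorphXn hd.
have comm0 h : commutator h (fun _ => 0) = fun _ => 0 :> R.
  by apply/funext => x; rewrite /commutator mulr0 subr0.
elim: N a d => [|N IH] a d aN dB hd ad.
  split=> // s x; apply/eqP; rewrite -subr_eq0.
  have [c ->] := commutator_span s dB hd; apply/eqP/big1 => i _.
  have a0 : a i = 0%N by move: aN; rewrite (bigD1 i) //=; case: (a i).
  have -> : d = fun _ => 0 by apply/funext => y; have := ad i y; rewrite a0.
  by rewrite comm0 mulr0.
split; first exact: lin.
move=> s; have [c hc] := commutator_span s dB hd.
apply: eq_diffop_le (fun x => esym (hc x)) _.
apply: diffop_le_sum => i; apply: diffop_leZ.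
case ai: (a i) => [|m].
  have -> : d = fun _ => 0 by apply/funext => y; have := ad i y; rewrite ai.
  by rewrite comm0; apply: diffop_le0.
apply: (IH (fun j => if j == i then m else a j)).
- rewrite -ltnS; apply: leq_trans aN.
  rewrite (bigD1 i) // [X in (_ < X)%N](bigD1 i) //= eqxx ai addSn ltnS.
  by rewrite leq_add2l leq_sum // => j /negbTE ->.
- exact: commutator_zmod_morphism.
- exact: commutator_frobenius_linear.
move=> j x; case: eqP => [->|_].
  by rewrite -iterSr -ai ad.
rewrite iter_commutatorC.
have -> : iter (a j) (commutator (g j)) d = fun _ => 0.
  by apply/funext => y; apply: ad.
by rewrite comm0.
Qed.

(** ad(g_i)^q = ad(g_i^q) annihilates d, so every nilpotency exponent can be taken equal to q. *)
Lemma frobenius_linear_diffop d :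
  zmod_morphism d -> frobenius_linear e d -> exists N, diffop_le phi N d.
Proof.
move=> dB hd; exists (\sum_(i < n) p ^ e)%N.
apply: (@iter_commutator_diffop _ (fun _ => p ^ e)%N) => // i x.
by rewrite iter_commutator_frobenius // /commutator hd subrr.
Qed.

End DiffopFrobenius.

(** Expand x over the g_i, then each coefficient over the h_j: the products h_j^(p^e) g_i span over
    the p^(e+f)-th powers. *)
Lemma frobenius_span_mul p (R : comPzRingType) (p_prime : prime p)
    (p0 : p%:R = 0 :> R) e f m n (g : 'I_m -> R) (h : 'I_n -> R) :
  frobenius_span p e g -> frobenius_span p f h ->
  exists (k : nat) (u : 'I_k -> R), frobenius_span p (e + f) u.
Proof.
move=> gP hP; pose T := ('I_m * 'I_n)%type.
pose u (ij : T) := h ij.2 ^+ (p ^ e) * g ij.1.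
exists #|{: T}|, (fun i => u (enum_val i)) => x.
have [c ->] := gP x; pose d i := projT1 (cid (hP (c i))).
have dP i : c i = \sum_j d i j ^+ (p ^ f) * h j by rewrite /d; case: cid.
exists (fun i => let ij := enum_val i in d ij.1 ij.2).
rewrite -(big_enum_val (fun ij : T => d ij.1 ij.2 ^+ (p ^ (e + f)) * u ij)).
rewrite -(pair_big xpredT xpredT (fun i j => d i j ^+ (p ^ (e + f)) * u (i, j))) /=.
apply: eq_bigr => i _; rewrite [in LHS]dP frobenius_sum // mulr_suml.
by apply: eq_bigr => j _; rewrite /u exprMn -exprM -expnD mulrA [(f + e)%N]addnC.
Qed.

(** The exponent given by F-finiteness is at least 1, so repeated addition of it passes any k; k
    will be an order of operators. *)
Lemma F_finite_span p (R : comPzRingType) (p_prime : prime p)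
    (p0 : p%:R = 0 :> R) k :
  F_finite p R -> exists (e n : nat) (g : 'I_n -> R),
    (k <= e)%N /\ frobenius_span p e g.
Proof.
case=> e [n [g [e0 gP]]].
elim: k => [|k [f [m [h [kf hP]]]]]; first by exists e, n, g.
have [l [u uP]] := frobenius_span_mul p_prime p0 gP hP.
by exists (e + f)%N, l, u; split=> //; rewrite -add1n leq_add.
Qed.

(** * Submodules of free modules over a Noetherian ring *)

Section Noetherian.
Variable S : comPzRingType.
Hypothesis noethS : noetherian S.

Lemma ideal_fin_gen (P : S -> Prop) :
  P 0 -> (forall a x y, P x -> P y -> P (a * x + y)) ->
  exists (n : nat) (g : 'I_n -> S),
    forall x, P x <-> exists c : 'I_n -> S, x = \sum_i c i * g i.
Proof.
move=> P0 PD; pose Q : {pred S^o} := fun x => `[< P x >].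
have QC : GRing.submod_closed Q.
  split; first exact/asboolP.
  by move=> a x y /asboolP Px /asboolP Py; apply/asboolP/PD.
pose m := GRing.isSubmodClosed.Build S S^o Q QC.
pose I : submodClosed S^o := HB.pack Q m.
have [n [g gP]] := noethS I; exists n, g => x; split.
  by move=> Px; apply/gP; apply/asboolP.
by move=> /gP /asboolP.
Qed.

Definition submodule n (L : 'rV[S]_n -> Prop) :=
  L 0 /\ forall a x y, L x -> L y -> L (a *: x + y).

Definition row_span t n (G : 'M[S]_(t, n)) (x : 'rV[S]_n) :=
  exists c : 'rV[S]_t, x = c *m G.

Lemma submodule_sum n (L : 'rV[S]_n -> Prop) t (c : 'rV[S]_t) (G : 'M_(t, n)) :
  submodule L -> (forall i, L (row i G)) -> L (c *m G).
Proof.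
move=> [L0 LD] LG; rewrite mulmx_sum_row.
elim: (index_enum _) => [|i r IH]; first by rewrite big_nil.
by rewrite big_cons; apply: LD.
Qed.

Lemma submodule_scale n (L : 'rV[S]_n -> Prop) a x :
  submodule L -> L x -> L (a *: x).
Proof. by move=> [L0 LD] Lx; rewrite -[_ *: _]addr0; apply: LD. Qed.

Lemma submoduleD n (L : 'rV[S]_n -> Prop) x y :
  submodule L -> L x -> L y -> L (x + y).
Proof. by move=> [_ LD] Lx Ly; rewrite -[x]scale1r; apply: LD. Qed.

Lemma submoduleB n (L : 'rV[S]_n -> Prop) x y :
  submodule L -> L x -> L y -> L (x - y).
Proof. by move=> [_ LD] Lx Ly; rewrite addrC -scaleN1r; apply: LD. Qed.

(** Induction on the number i of coordinates allowed to be nonzero. The values of the last of them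
    form an ideal; lifts of its generators, together with generators of the part where this
    coordinate vanishes, generate the submodule. *)
Lemma submodule_fin_gen n (L : 'rV[S]_n -> Prop) :
  submodule L -> exists t (G : 'M[S]_(t, n)), forall x, L x <-> row_span G x.
Proof.
move=> LS; suff fg i (K : 'rV[S]_n -> Prop) : submodule K ->
    (forall x, K x -> forall j : 'I_n, (i <= j)%N -> x 0 j = 0) ->
    exists t (G : 'M[S]_(t, n)), forall x, K x <-> row_span G x.
  by apply: (fg n) => // x _ j; rewrite leqNgt ltn_ord.
elim: i K {L LS} => [|i IH] L LS Li.
  exists 0%N, 0 => x; split.
    move=> Lx; exists 0; rewrite mulmx0; apply/rowP => j.
    by rewrite (Li x Lx) // mxE.
  by case=> c ->; rewrite mulmx0; case: LS.
case: (leqP n i) => [le_ni|lt_in].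
  apply: IH => // x _ j le_ij.
  by have := leq_ltn_trans (leq_trans le_ni le_ij) (ltn_ord j); rewrite ltnn.
pose o := Ordinal lt_in.
have [||m [g gP]] := @ideal_fin_gen (fun a => exists2 x, L x & x 0 o = a).
- by exists 0; [case: LS | rewrite mxE].
- move=> a _ _ [x Lx <-] [y Ly <-]; exists (a *: x + y); last by rewrite !mxE.
  by case: LS => _; apply.
have gI j : exists2 x, L x & x 0 o = g j.
  apply/gP; exists (fun k => (k == j)%:R).
  rewrite (bigD1 j) //= eqxx mul1r big1 ?addr0 // => k /negbTE ->.
  by rewrite mul0r.
pose y j := s2val (cid2 (gI j)).
have Ly j : L (y j) by rewrite /y; case: cid2.
have yo j : y j 0 o = g j by rewrite /y; case: cid2.
pose Y := \matrix_j y j.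
have [|x [Lx xo] j le_ij|t [G GP]] := IH (fun x => L x /\ x 0 o = 0).
- split; first by split; [case: LS | rewrite mxE].
  move=> a x z [Lx xo] [Lz zo]; split; last by rewrite !mxE xo zo mulr0 addr0.
  by case: LS => _; apply.
- case: (ltngtP i j) => [lt_ij|lt_ji|eq_ij]; first exact: Li.
    by move: le_ij; rewrite leqNgt lt_ji.
  by rewrite -xo; congr (x 0 _); apply: val_inj.
have LY c : L (c *m Y) by apply: submodule_sum => // j; rewrite rowK.
exists (m + t)%N, (col_mx Y G) => x; split.
  move=> Lx; have [|c cP] := (gP (x 0 o)).1; first by exists x.
  have [|d dP] := (GP (x - (\row_j c j) *m Y)).1.
    split; first exact: submoduleB.
    rewrite mxE mxE [X in _ - X]mxE cP; apply/eqP; rewrite subr_eq0; apply/eqP.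
    by apply: eq_bigr => j _; rewrite !mxE yo.
  by exists (row_mx (\row_j c j) d); rewrite mul_row_col -dP addrC subrK.
case=> c ->; rewrite -[c]hsubmxK mul_row_col; apply: submoduleD => //.
by have [|] := (GP (rsubmx c *m G)).2 _ => //; exists (rsubmx c).
Qed.

Lemma row_span_row t n (G : 'M[S]_(t, n)) i : row_span G (row i G).
Proof. by exists (delta_mx 0 i); rewrite -rowE. Qed.

(** Without a maximal element, choice yields a strictly increasing chain; its union is finitely
    generated, and a stage containing the generators is already the whole union. *)
Lemma submodule_maximal n (P : ('rV[S]_n -> Prop) -> Prop)
    (N0 : 'rV[S]_n -> Prop) :
  (forall N, P N -> submodule N) -> P N0 ->
  exists2 N, P N &
    forall N', P N' -> (forall x, N x -> N' x) -> forall x, N' x -> N x.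
Proof.
move=> PS PN0; apply: contrapT => nomax.
have next (N : {N | P N}) : exists N' : {N | P N},
    (forall x, sval N x -> sval N' x) /\ exists x, sval N' x /\ ~ sval N x.
  apply: contrapT => no; apply: nomax; exists (sval N); first exact: (svalP N).
  move=> N' PN' NN' x N'x; apply: contrapT => nNx; apply: no.
  by exists (exist _ N' PN'); split=> //; exists x.
pose f N := sval (cid (next N)).
have fP N : (forall x, sval N x -> sval (f N) x) /\
    exists x, sval (f N) x /\ ~ sval N x by rewrite /f; case: cid.
pose u k := iter k f (exist _ N0 PN0).
have uS k : submodule (sval (u k)) by apply/PS/svalP.
have mono j k x : (j <= k)%N -> sval (u j) x -> sval (u k) x.
  move=> /subnK <-; elim: (k - j)%N => [//|i IH] /IH.
  by rewrite addSn; case: (fP (u (i + j)%N)) => h _; apply: h.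
have [|t [G GP]] := @submodule_fin_gen n (fun x => exists k, sval (u k) x).
  split; first by exists 0%N; case: (uS 0%N).
  move=> a x y [j jx] [k ky]; exists (maxn j k).
  case: (uS (maxn j k)) => _; apply.
    by apply: mono jx; apply: leq_maxl.
  by apply: mono ky; apply: leq_maxr.
have stage i : exists k, sval (u k) (row i G) by apply/GP/row_span_row.
pose K := (\max_i sval (cid (stage i)))%N.
have uK i : sval (u K) (row i G).
  have h : (sval (cid (stage i)) <= K)%N by apply: (bigmax_sup i).
  exact: (mono _ _ _ h (svalP (cid (stage i)))).
case: (fP (u K)) => _ [x [ux]]; apply.
have [|c ->] := (GP x).1; first by exists K.+1.
exact: submodule_sum.
Qed.

End Noetherian.

(** * Artin-Rees and flatness of the completion *)

Section ArtinRees.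
Variables (S : comPzRingType) (J : submodClosed S^o).
Hypothesis noethS : noetherian S.

Lemma ideal_pow_exp k f : f \in J -> f ^+ k \in ideal_pow J k.
Proof. by move=> fJ; elim: k => [//|k IH]; rewrite exprS; apply: ideal_powJM. Qed.

Definition is_ideal (Q : S -> Prop) :=
  Q 0 /\ forall a x y, Q x -> Q y -> Q (a * x + y).

Lemma is_idealM (Q : S -> Prop) a x : is_ideal Q -> Q x -> Q (a * x).
Proof. by move=> [Q0 QD] Qx; rewrite -[_ * _]addr0; apply: QD. Qed.

Lemma is_idealD (Q : S -> Prop) x y : is_ideal Q -> Q x -> Q y -> Q (x + y).
Proof. by move=> [_ QD] Qx Qy; rewrite -[x]mul1r; apply: QD. Qed.

Section Generators.
Variables (r : nat) (f : 'I_r -> S).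
Hypothesis fJ : forall x, x \in J -> exists c : 'I_r -> S, x = \sum_i c i * f i.

Lemma ideal_powS_sub N (Q : S -> Prop) :
    is_ideal Q -> (forall i b, b \in ideal_pow J N -> Q (f i * b)) ->
  forall x, x \in ideal_pow J N.+1 -> Q x.
Proof.
move=> QI Qf x /ideal_powSP[s hs ->]; have [Q0 _] := QI.
rewrite big_seq; apply: big_ind => //; first by move=> y z; apply: (is_idealD QI).
move=> -[a b] /hs [/= /fJ [c ->] bJ].
rewrite mulr_suml; apply: big_ind => //; first by move=> y z; apply: (is_idealD QI).
by move=> i _; rewrite -mulrA; apply: (is_idealM _ QI); apply: Qf.
Qed.

(** Pigeonhole: a monomial of degree N + 1 in the f_i is divisible by some f_i^(e_i). The induction
    splits off one factor f_i and replaces Q by (Q : f_i), for which e_i drops by one. *)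
Lemma ideal_pow_sub N (Q : S -> Prop) (e : 'I_r -> nat) :
    is_ideal Q -> (forall i, Q (f i ^+ e i)) -> (\sum_i e i <= N)%N ->
  forall x, x \in ideal_pow J N.+1 -> Q x.
Proof.
elim: N Q e => [|N IH] Q e QI Qf eN; apply: ideal_powS_sub => // i b bJ.
  have ei : e i = 0%N by move: eN; rewrite (bigD1 i) //=; case: (e i).
  by have := is_idealM (f i * b) QI (Qf i); rewrite ei mulr1.
case ei: (e i) => [|m].
  by have := is_idealM (f i * b) QI (Qf i); rewrite ei mulr1.
apply: (IH (fun y => Q (f i * y)) (fun j => if j == i then m else e j) _ _ _ _ bJ).
- split; first by rewrite mulr0; case: QI.
  move=> u y z Qy Qz; rewrite mulrDr mulrCA; apply: (is_idealD QI) Qz.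
  exact: (is_idealM _ QI).
- move=> j; case: eqP => [->|_]; last exact: (is_idealM _ QI).
  by rewrite -exprS -ei.
- rewrite -ltnS; apply: leq_trans eN.
  rewrite (bigD1 i) // [X in (_ < X)%N](bigD1 i) //= eqxx ei addSn ltnS.
  by rewrite leq_add2l leq_sum // => j /negbTE ->.
Qed.

End Generators.

Definition in_pow k n (x : 'rV[S]_n) := forall i, x 0 i \in ideal_pow J k.

Lemma in_pow_le k l n (x : 'rV[S]_n) : (k <= l)%N -> in_pow l x -> in_pow k x.
Proof. by move=> kl hx i; apply: ideal_pow_le (hx i). Qed.

(* A weak form of the Artin-Rees lemma for the row space L of G.  Let N be
   maximal among the submodules with  J^k L <= N  and  N :&: L <= J^k L.  For f
   in J the submodules (N : f^c) become stationary, whence f^c S^n <= N for c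
   large; so J^l S^n <= N for some l, and J^l S^n :&: L <= N :&: L <= J^k L.   *)
Lemma artin_rees t n (G : 'M[S]_(t, n)) k :
  exists l, forall c : 'rV_t, in_pow l (c *m G) ->
    exists2 a, in_pow k a & c *m G = a *m G.
Proof.
pose H (x : 'rV[S]_n) := exists2 a : 'rV_t, in_pow k a & x = a *m G.
pose P N := [/\ submodule N, forall x, H x -> N x &
                forall x, N x -> row_span G x -> H x].
have HS : submodule H.
  split; first by exists 0; rewrite ?mul0mx // => i; rewrite mxE rpred0.
  move=> s _ _ [a ak ->] [b bk ->]; exists (s *: a + b).
    by move=> i; rewrite !mxE rpredD // ideal_powM.
  by rewrite mulmxDl scalemxAl.
have [||N [NS HN NL] Nmax] := @submodule_maximal _ noethS n P H.
- by move=> N [].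
- by split.
have [N0 ND] := NS.
have NZ a x : N x -> N (a *: x) by apply: submodule_scale.
have nil f : f \in J -> exists c, forall x, N (f ^+ c *: x).
  move=> fJ; pose col c (x : 'rV[S]_n) := N (f ^+ c *: x).
  have colS c : submodule (col c).
    split; first by rewrite /col scaler0.
    by move=> a x y hx hy; rewrite /col scalerDr scalerA mulrC -scalerA; apply: ND.
  have col_le c c' x : (c <= c')%N -> col c x -> col c' x.
    by move=> /subnK <- h; rewrite /col exprD -scalerA; apply: NZ.
  have [|_ [c ->] cmax] := @submodule_maximal _ noethS n
    (fun M => exists c, M = col c) (col 0%N) _ (ex_intro _ 0%N erefl).
    by move=> _ [c ->].
  (* The summand c reaches the stable range of the (N : f^c); the summand k puts f^c' in J^k. *)
  pose c' := (c + k)%N; exists c' => x.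
  have stat y : N (f ^+ c' *: (f ^+ c' *: y)) -> N (f ^+ c' *: y).
    rewrite scalerA -exprD => h; apply: (@col_le c) (leq_addr _ _) _.
    apply: (cmax (col (c' + c')%N)) h; first by exists (c' + c')%N.
    by move=> z; apply: col_le; rewrite -addnA leq_addr.
  pose N' y := exists2 z, N z & exists s, y = z + f ^+ c' *: s.
  apply: (Nmax N'); last by exists 0 => //; exists x; rewrite add0r.
    split.
    - split; first by exists 0 => //; exists 0; rewrite scaler0 addr0.
      move=> a _ _ [y Ny [s ->]] [z Nz [u ->]].
      exists (a *: y + z); first exact: ND.
      exists (a *: s + u).
      by rewrite !scalerDr addrACA !scalerA [f ^+ c' * a]mulrC.
    - by move=> y /HN Ny; exists y => //; exists 0; rewrite scaler0 addr0.
    (* If x = y + f^c' s is in L with y in N, then f^c' x is in J^k L, hence in N, so f^(2c') s is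
       in N. Stationarity puts f^c' s in N, hence x in N. *)
    move=> _ [y Ny [s ->]] Ly; have [d dP] := Ly.
    apply: NL => //; apply: submoduleD => //; apply: stat.
    have -> : f ^+ c' *: (f ^+ c' *: s) = f ^+ c' *: (d *m G) - f ^+ c' *: y.
      by rewrite -dP scalerDr addrC addKr.
    apply: submoduleB => //; last exact: NZ.
    apply: HN; exists (f ^+ c' *: d); last by rewrite scalemxAl.
    move=> i; rewrite mxE mulrC ideal_powM //.
    apply: (@ideal_pow_le _ _ k c'); first exact: leq_addl.
    exact: ideal_pow_exp.
  by move=> y Ny; exists y => //; exists 0; rewrite scaler0 addr0.
have [r [f fJ]] := noethS J.
have fi i : f i \in J.
  apply/fJ; exists (fun j => (j == i)%:R).
  rewrite (bigD1 i) //= eqxx mul1r big1 ?addr0 // => j /negbTE ->.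
  by rewrite mul0r.
pose e i := sval (cid (nil _ (fi i))).
have eP i x : N (f i ^+ e i *: x) by rewrite /e; case: cid.
(* One more than the sum of the e_i, so that [ideal_pow_sub] applies to the ideal of all a with a
   S^n inside N. *)
exists (\sum_i e i).+1%N => c hc; apply: NL; last by exists c.
rewrite [c *m G]row_sum_delta; apply: big_ind => //.
  by move=> x y; apply: submoduleD.
move=> i _; pose Q a := forall x, N (a *: x).
apply: (@ideal_pow_sub r f _ _ Q e _ _ (leqnn _) _ (hc i)) => //.
- by move=> x /fJ.
- split; first by move=> x; rewrite scale0r.
  move=> a x y hx hy z; rewrite scalerDl -scalerA.
  by apply: submoduleD => //; apply: NZ.
Qed.

Lemma ideal_pow_limit (s : nat -> S) :
  (forall k, s k.+1 - s k \in ideal_pow J k) ->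
  exists x : completion J, forall k, x k = residue_of k (s k).
Proof.
move=> hs; suff tr k :
    residue_trans (residue_of (J := J) k.+1 (s k.+1)) = residue_of k (s k).
  by exists (Completion tr).
by rewrite residue_transE; apply/residue_eqP.
Qed.

Definition approx k n (x : 'rV[completion J]_n) (y : 'rV[S]_n) :=
  forall i, x 0 i k = residue_of k (y 0 i).

Lemma approx_eq n (x x' : 'rV[completion J]_n) (y : nat -> 'rV[S]_n) :
  (forall k, approx k x (y k)) -> (forall k, approx k x' (y k)) -> x = x'.
Proof.
move=> hx hx'; apply/rowP => i; apply: completionP => k.
by rewrite hx hx'.
Qed.

Lemma approx_le k l n (x : 'rV[completion J]_n) y :
  (k <= l)%N -> approx l x y -> approx k x y.
Proof. by move=> kl h i; apply/esym/(coord_repr kl). Qed.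

Lemma coord_sum k (I : Type) (r : seq I) (f : I -> completion J) :
  (\sum_(i <- r) f i) k = \sum_(i <- r) f i k.
Proof. by elim: r => [|i r IH]; rewrite ?big_nil // !big_cons -IH. Qed.

Lemma approx_mulmx k m n (x : 'rV[completion J]_m) y (B : 'M[S]_(m, n)) :
  approx k x y -> approx k (x *m map_mx completion_of B) (y *m B).
Proof.
move=> h i; rewrite !mxE coord_sum rmorph_sum; apply: eq_bigr => j _ /=.
by rewrite h mxE rmorphM.
Qed.

Lemma approx_exists n (x : 'rV[completion J]_n) k : exists y, approx k x y.
Proof.
by exists (\row_i repr (x 0 i k)) => i; rewrite mxE residue_ofK.
Qed.

Lemma approxB k n (x : 'rV[completion J]_n) y z :
  approx k x y -> (approx k x z <-> in_pow k (y - z)).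
Proof.
move=> h; split=> hz i.
  by rewrite !mxE; apply/residue_eqP; rewrite -h -hz.
by rewrite h; apply/residue_eqP; have := hz i; rewrite !mxE.
Qed.

(** Artin-Rees replaces the difference of successive coefficient vectors by a vector in J^k with the
    same image under K. The corrected coefficients converge, so the row space is closed. *)
Lemma approx_closure t n (K : 'M[S]_(t, n)) (x : 'rV[completion J]_n) :
  (forall k, exists c, approx k x (c *m K)) ->
  exists w, x = w *m map_mx completion_of K.
Proof.
move=> hx; pose lev k := sval (cid (artin_rees K k)).
have levP k c : in_pow (lev k) (c *m K) -> exists2 a, in_pow k a & c *m K = a *m K.
  by rewrite /lev; case: cid => l h; apply: h.
(* The sum makes L nondecreasing and at least [lev k + k]: enough for Artin-Rees and for an
   approximation modulo J^k. *)
pose L k := (\sum_(i < k.+1) (lev i + i))%N.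
have LS k : (L k <= L k.+1)%N by rewrite /L [X in (_ <= X)%N]big_ord_recr leq_addr.
have Lk k : (lev k + k <= L k)%N by rewrite /L big_ord_recr leq_addl.
pose c k := sval (cid (hx (L k))).
have cP k : approx (L k) x (c k *m K) by rewrite /c; case: cid.
have step k : exists2 a, in_pow k a & (c k.+1 - c k) *m K = a *m K.
  apply: levP; apply: (@in_pow_le _ (L k)).
    exact: leq_trans (leq_addr _ _) (Lk k).
  rewrite mulmxBl; apply/(@approxB _ _ x); last exact: cP.
  exact: approx_le (cP k.+1).
pose a k := s2val (cid2 (step k)).
have ak k : in_pow k (a k) by rewrite /a; case: cid2.
have aK k : (c k.+1 - c k) *m K = a k *m K by rewrite /a; case: cid2.
pose w k := c 0%N + \sum_(i < k) a i.
have wK k : w k *m K = c k *m K.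
  elim: k => [|k IH]; first by rewrite /w big_ord0 addr0.
  by rewrite /w big_ord_recr /= addrA mulmxDl IH -aK -mulmxDl addrC subrK.
have wlim i : exists y : completion J, forall k, y k = residue_of k (w k 0 i).
  apply: ideal_pow_limit => k; rewrite /w big_ord_recr /= addrA.
  by rewrite [X in X - _]mxE addrAC subrr add0r; apply: ak.
pose y i := sval (cid (wlim i)).
have yP i k : y i k = residue_of k (w k 0 i) by rewrite /y; case: cid.
exists (\row_i y i); apply: (@approx_eq _ _ _ (fun k => w k *m K)) => k.
  rewrite wK; apply: approx_le (cP k).
  exact: leq_trans (leq_addl _ _) (Lk k).
by apply: approx_mulmx => i; rewrite mxE yP.
Qed.

(* The equational criterion of flatness of the completion over S. *)
Lemma completion_flat m n (B : 'M[S]_(m, n)) (x : 'rV[completion J]_m) :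
  x *m map_mx completion_of B = 0 ->
  exists t (K : 'M[S]_(t, m)) w, K *m B = 0 /\ x = w *m map_mx completion_of K.
Proof.
move=> xB0.
have [|t [K KP]] := @submodule_fin_gen S noethS m (fun y => y *m B = 0).
  split; first by rewrite mul0mx.
  by move=> a y z yB zB; rewrite mulmxDl -scalemxAl yB zB scaler0 addr0.
have KB : K *m B = 0.
  apply/row_matrixP => i; rewrite row_mul row0; apply/KP; exact: row_span_row.
have [|w wP] := @approx_closure t m K x; last by exists t, K, w.
(* As y approximates x, yB is in J^l and equals aB with a in J^k; then y - a is an exact solution
   over S that still approximates x modulo J^k. *)
move=> k; have [l lP] := artin_rees B k.
have [y yP] := approx_exists x (maxn k l).
have [|a ak aB] := lP y.
  move: (approx_le (leq_maxr k l) (approx_mulmx B yP)); rewrite xB0 => h i.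
  have := h i; rewrite mxE /= -(rmorph0 (residue_of l)) => /esym/residue_eqP.
  by rewrite subr0.
have [|c cP] := (KP (y - a)).1; first by rewrite mulmxBl aB subrr.
exists c; rewrite -cP; apply/(approxB _ (approx_le (leq_maxl k l) yP)).
by rewrite opprB addrC subrK.
Qed.

(** J^k is finitely generated, and [approx_closure] for the column of its generators shows that its
    extension to the completion is closed; so this extension is the kernel of the projection to
    S/J^k. *)
Lemma coord_eq0_mul k (x : completion J) : x k = 0 ->
  exists n (a : 'I_n -> S) (y : 'I_n -> completion J),
    (forall i, a i \in ideal_pow J k) /\ x = \sum_i completion_of (a i) * y i.
Proof.
move=> xk0.
have [||n [g gP]] := @ideal_fin_gen S noethS (fun a => a \in ideal_pow J k).
- exact: rpred0.
- by move=> a b c hb hc; rewrite rpredD // ideal_powM.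
pose K : 'M[S]_(n, 1) := \matrix_(i, j) g i.
have [l|w wP] := @approx_closure n 1 K (const_mx x).
  pose s := repr (x (maxn k l)).
  have hs : residue_of _ s = x (maxn k l) by apply: residue_ofK.
  have [|c cP] := (gP s).1.
    have := coord_repr (leq_maxl k l) hs.
    by rewrite xk0 -(rmorph0 (residue_of k)) => /residue_eqP; rewrite subr0.
  exists (\row_i c i) => i; rewrite !mxE -(coord_repr (leq_maxr k l) hs) cP.
  by congr residue_of; apply: eq_bigr => j _; rewrite !mxE.
exists n, g, (fun i => w 0 i); split.
  move=> i; apply/gP; exists (fun j => (j == i)%:R).
  rewrite (bigD1 i) //= eqxx mul1r big1 ?addr0 // => j /negbTE ->.
  by rewrite mul0r.
have := congr1 (fun M : 'rV_1 => M 0 0) wP; rewrite !mxE => ->.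
by apply: eq_bigr => i _; rewrite !mxE mulrC.
Qed.

End ArtinRees.

(** * Operators on the completion *)

Section Density.
Variables (A S : comPzRingType) (phi : {rmorphism A -> S}) (J : submodClosed S^o).

Local Notation "S^" := (completion J) (at level 0).
Local Notation psi := (completion_alg phi J).
Local Notation iota := (@completion_of S J).
Local Notation const a := (a *: (1 : diffop psi)).

Lemma diffop_le_commutator (R : comPzRingType) (chi : {rmorphism A -> R}) n
    (E : diffop chi) b :
  diffop_le chi n.+1 E -> diffop_le chi n (E * (b *: (1 : diffop chi)) - b *: E).
Proof. by case=> _ /(_ b). Qed.

Lemma diffop_sumE (R : comPzRingType) (chi : {rmorphism A -> R}) (I : Type)
    (r : seq I) (F : I -> diffop chi) x :
  (\sum_(i <- r) F i) x = \sum_(i <- r) F i x.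
Proof. by elim: r => [|i r IH]; rewrite ?big_nil // !big_cons -IH. Qed.

(* F lies in J^k D(S^). *)
Definition diffop_pow k (F : diffop psi) :=
  exists2 r : seq (S * diffop psi),
    {in r, forall am, am.1 \in ideal_pow J k} &
    F = \sum_(am <- r) iota am.1 *: am.2.

Lemma diffop_pow0 k : diffop_pow k 0.
Proof. by exists [::] => //; rewrite big_nil. Qed.

Lemma diffop_powD k F G : diffop_pow k F -> diffop_pow k G -> diffop_pow k (F + G).
Proof.
move=> [r hr ->] [s hs ->]; exists (r ++ s); last by rewrite big_cat.
by move=> am; rewrite mem_cat => /orP[/hr|/hs].
Qed.

Lemma diffop_pow_sum k (I : eqType) (r : seq I) (F : I -> diffop psi) :
  {in r, forall i, diffop_pow k (F i)} -> diffop_pow k (\sum_(i <- r) F i).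
Proof.
move=> hF; rewrite big_seq; elim/big_rec: _ => [|i G /hF]; last exact: diffop_powD.
exact: diffop_pow0.
Qed.

Lemma diffop_powB k F G : diffop_pow k F -> diffop_pow k G -> diffop_pow k (F - G).
Proof.
move=> hF [s hs ->]; apply: diffop_powD => //.
exists [seq (- am.1, am.2) | am <- s].
  by move=> am /mapP[bn /hs h ->] /=; rewrite rpredN.
rewrite big_map -sumrN; apply: eq_bigr => am _ /=.
by rewrite rmorphN scaleNr.
Qed.

Lemma diffop_powZ k a F : a \in J -> diffop_pow k F -> diffop_pow k.+1 (iota a *: F).
Proof.
move=> aJ [r hr ->]; exists [seq (a * am.1, am.2) | am <- r].
  by move=> am /mapP[bn /hr h ->] /=; apply: ideal_powJM.
by rewrite big_map scaler_sumr; apply: eq_bigr => am _; rewrite scalerA rmorphM.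
Qed.

Lemma diffop_powMr k F G : diffop_pow k F -> diffop_pow k (F * G).
Proof.
move=> [r hr ->]; exists [seq (am.1, am.2 * G) | am <- r].
  by move=> am /mapP[bn /hr h ->].
rewrite big_map mulr_suml; apply: eq_bigr => am _; exact: diffopP.
Qed.

Lemma diffop_pow_coord k F x : diffop_pow k F -> F x k = 0.
Proof.
move=> [r hr ->]; rewrite diffop_sumE coord_sum big_seq big1 // => am /hr h /=.
have -> : residue_of k am.1 = 0 :> residue J k.
  by rewrite -(rmorph0 (residue_of k)); apply/residue_eqP; rewrite subr0.
by rewrite mul0r.
Qed.

Lemma diffop_pow_eq0 F : (forall k, diffop_pow k F) -> F = 0.
Proof.
by move=> hF; apply: diffopP => x; apply: completionP => k; rewrite diffop_pow_coord.
Qed.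

(** Continuity at the level of operators. In E b c = [E, b] c + b E c with b in J, the first term
    involves an operator of smaller order and the second gains a factor in J; induction on n, then
    on k. *)
Lemma diffop_pow_mul n k (E : diffop psi) a :
  diffop_le psi n E -> a \in ideal_pow J (k + n) ->
  diffop_pow k (E * const (iota a)).
Proof.
elim: n k E a => [|n IHn] k E a.
  case=> _ hE; rewrite addn0 => ak; exists [:: (a, E)].
    by move=> am; rewrite inE => /eqP ->.
  by rewrite big_seq1; apply: diffopP => x; apply: hE.
elim: k a => [|k IHk] a hE.
  move=> _; exists [:: (1, E * const (iota a))] => //.
  by rewrite big_seq1 rmorph1 scale1r.
rewrite addSn => /ideal_powSP[r hr ->].
have -> : E * const (iota (\sum_(ab <- r) ab.1 * ab.2)) =
    \sum_(ab <- r) E * const (iota (ab.1 * ab.2)).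
  by rewrite rmorph_sum scaler_suml mulr_sumr.
apply: diffop_pow_sum => -[b c] /hr [/= bJ cJ].
have -> : E * const (iota (b * c)) =
    (E * const (iota b) - iota b *: E) * const (iota c) +
    iota b *: (E * const (iota c)).
  apply: diffopP => x; rewrite rmorphM /=.
  by rewrite -[X in _ = X + _]/(_ - _) subrK mulrA.
apply: diffop_powD; last by apply: diffop_powZ => //; apply: IHk.
by apply: IHn; [apply: diffop_le_commutator | rewrite addSnnS].
Qed.

Lemma diffop_pow_smul n k (E : diffop psi) (u : S^) :
  diffop_le psi n E -> ideal_pow_smul J (k + n) u -> diffop_pow k (E * const u).
Proof.
move=> hE [r hr ->]; rewrite scaler_suml mulr_sumr.
apply: diffop_pow_sum => -[a x] /hr /= ak.
have -> : E * const (a *: x) = (E * const (iota a)) * const x.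
  by apply: diffopP => y; rewrite /= completion_scaleE mulrA.
by apply/diffop_powMr/(diffop_pow_mul hE).
Qed.

Hypothesis noethS : noetherian S.

Lemma coord_eq0_smul k (x : S^) : x k = 0 -> ideal_pow_smul J k x.
Proof.
move=> /(coord_eq0_mul noethS) [n [a [y [ak ->]]]].
exists [seq (a i, y i) | i <- index_enum 'I_n]; last by rewrite big_map.
by move=> am /mapP[i _ ->]; apply: ak.
Qed.

(** The image of S is dense: s can be chosen with x - iota s in J^(k+n) S^, which an operator of
    order n sends to zero modulo J^k. *)
Lemma diffop_dense (E F : diffop psi) :
  (forall s, E (iota s) = F (iota s)) -> E = F.
Proof.
move=> EF; apply/eqP; rewrite -subr_eq0; apply/eqP.
have {}EF s : (E - F) (iota s) = 0 by rewrite /= EF subrr.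
move: (E - F) EF => G {E F} G0; apply: diffopP => x; apply: completionP => k.
have [n hG] := diffop_proof G.
pose s := repr (x (k + n)%N).
have xs : ideal_pow_smul J (k + n) (x - iota s).
  by apply: coord_eq0_smul; rewrite /= residue_ofK subrr.
rewrite -[x in LHS](subrK (iota s)) raddfD /= G0 addr0.
(* Evaluating G composed with multiplication by x - iota s at 1 gives the value of G at x - iota
   s. *)
by have := diffop_pow_coord 1 (diffop_pow_smul hG xs); rewrite /= mulr1.
Qed.

Lemma diffop_ext1 : diffop_ext J (1 : diffop phi) = 1.
Proof. by apply: diffop_dense => s; rewrite diffop_ext_of. Qed.

Lemma diffop_extM (d e : diffop phi) :
  diffop_ext J (d * e) = diffop_ext J d * diffop_ext J e.
Proof.
apply: diffop_dense => s; rewrite -[RHS]/(diffop_ext J d (diffop_ext J e _)).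
by rewrite !diffop_ext_of.
Qed.

Lemma natural_mapZ a (t : completed_tensor phi J) :
  natural_map (a *: t) = iota a *: natural_map t.
Proof.
elim/tensor_ind: t => [u d|x y hx hy]; last first.
  pose T : lmodType S := completed_tensor phi J.
  have nuB := raddfB (@natural_map A S phi J).
  rewrite [a *: _](scalerBr a (x : T) y) (nuB (x : T) y).
  by rewrite (nuB (a *: x : T) (a *: y)) /= hx hy scalerBr.
rewrite -[a *: _]/(tensor_scale _ _) tensor_scaleE.
by rewrite -!/(ctens _ _) !natural_mapE completion_scaleE scalerA.
Qed.

End Density.

(** * Bijectivity of the natural map *)

Section TensorSums.
Variables (S : comPzRingType) (M N : lmodType S).

Lemma tens0l (y : N) : tens (0 : M) y = 0.
Proof. by apply: (addrI (tens 0 y)); rewrite addr0 -tensDl addr0. Qed.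

Lemma tens0r (x : M) : tens x (0 : N) = 0.
Proof. by apply: (addrI (tens x 0)); rewrite addr0 -tensDr addr0. Qed.

Lemma tensNl (x : M) (y : N) : tens (- x) y = - tens x y.
Proof. by apply: (addrI (tens x y)); rewrite -tensDl !subrr tens0l. Qed.

Lemma tens_suml (I : Type) (r : seq I) (f : I -> M) (y : N) :
  tens (\sum_(i <- r) f i) y = \sum_(i <- r) tens (f i) y.
Proof.
exact: (big_morph (fun x => tens x y) (fun a b => tensDl a b y) (tens0l y)).
Qed.

Lemma tens_sumr (I : Type) (r : seq I) (x : M) (f : I -> N) :
  tens x (\sum_(i <- r) f i) = \sum_(i <- r) tens x (f i).
Proof. exact: (big_morph (tens x) (tensDr x) (tens0r x)). Qed.

End TensorSums.

Section NaturalMapBijective.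
Variables (p : nat) (A S : comPzRingType) (phi : {rmorphism A -> S}).
Variable J : submodClosed S^o.
Hypotheses (p_prime : prime p) (p0 : p%:R = 0 :> S).
Hypothesis perfectA : forall a : A, exists b : A, a = b ^+ p.
Hypotheses (noethS : noetherian S) (FfinS : F_finite p S).

Local Notation iota := (@completion_of S J).
Local Notation psi := (completion_alg phi J).
Local Notation nat_map := (@natural_map A S phi J).

Lemma p0_completion : p%:R = 0 :> completion J.
Proof. by rewrite -(rmorph_nat iota) p0 rmorph0. Qed.

(** Set f(sum_i c_i^q g_i) = sum_i c_i^q k_i. The hypothesis on relations makes f independent of the
    coefficients, which also yields additivity and q-power linearity; perfectness of A then makes f
    a differential operator. *)
Lemma diffop_of_values e n (g k : 'I_n -> S) :
    frobenius_span p e g ->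
    (forall c : 'I_n -> S, \sum_i c i ^+ (p ^ e) * g i = 0 ->
       \sum_i c i ^+ (p ^ e) * k i = 0) ->
  exists2 d : diffop phi, frobenius_linear p e d & forall i, d (g i) = k i.
Proof.
move=> gP rel; pose c x := sval (cid (gP x)).
have cP x : x = \sum_i c x i ^+ (p ^ e) * g i by rewrite /c; case: cid.
pose f x := \sum_i c x i ^+ (p ^ e) * k i.
have fE x b : x = \sum_i b i ^+ (p ^ e) * g i -> f x = \sum_i b i ^+ (p ^ e) * k i.
  move=> xb; apply/eqP; rewrite -subr_eq0 -sumrB; apply/eqP.
  rewrite -[RHS](rel (fun i => c x i - b i)).
    by apply: eq_bigr => i _; rewrite frobeniusB // mulrBl.
  under eq_bigr do rewrite frobeniusB // mulrBl.
  by rewrite sumrB -cP -xb subrr.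
have fB : zmod_morphism f.
  move=> x y; rewrite (fE (x - y) (fun i => c x i - c y i)).
    by rewrite -sumrB; apply: eq_bigr => i _; rewrite frobeniusB // mulrBl.
  rewrite [in LHS](cP x) [in LHS](cP y) -sumrB.
  by apply: eq_bigr => i _; rewrite frobeniusB // mulrBl.
have fL : frobenius_linear p e f.
  move=> s x; rewrite (fE (s ^+ (p ^ e) * x) (fun i => s * c x i)).
    by rewrite mulr_sumr; apply: eq_bigr => i _; rewrite exprMn mulrA.
  rewrite [in LHS](cP x) mulr_sumr.
  by apply: eq_bigr => i _; rewrite exprMn mulrA.
have fD := frobenius_linear_diffop phi p_prime p0 perfectA gP fB fL.
exists (Diffop fD) => // i /=.
have delta (h : 'I_n -> S) : \sum_j (j == i)%:R ^+ (p ^ e) * h j = h i.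
  rewrite (bigD1 i) //= eqxx expr1n mul1r big1 ?addr0 // => j /negbTE ->.
  by rewrite frobenius0 // mul0r.
by rewrite (fE _ (fun j => (j == i)%:R)) delta.
Qed.

Lemma frobenius_linear_sum (E : diffop psi) e n (c g : 'I_n -> S) :
  frobenius_linear p e E ->
  E (iota (\sum_i c i ^+ (p ^ e) * g i)) =
  \sum_i iota (c i ^+ (p ^ e)) * E (iota (g i)).
Proof.
move=> hE; rewrite !raddf_sum; apply: eq_bigr => i _ /=.
by rewrite rmorphM rmorphXn hE [in RHS]rmorphXn.
Qed.

Lemma natural_map_surj (E : diffop psi) : exists t, nat_map t = E.
Proof.
have [n hE] := diffop_proof E.
have [e [m [g [le_ne gP]]]] := F_finite_span p_prime p0 n FfinS.
have {hE}hE : frobenius_linear p e E.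
  exact: frobenius_linear_le le_ne (diffop_le_frobenius p0_completion hE).
(* Frobenius is additive, so the relations form a submodule; the rows of R will generate it. *)
pose rel (c : 'rV[S]_m) := \sum_i c 0 i ^+ (p ^ e) * g i = 0.
have [|r [R RP]] := @submodule_fin_gen S noethS m rel.
  split; first by rewrite /rel big1 // => i _; rewrite mxE frobenius0 // mul0r.
  move=> a x y hx hy; rewrite /rel.
  transitivity (a ^+ (p ^ e) * (\sum_i x 0 i ^+ (p ^ e) * g i) +
                \sum_i y 0 i ^+ (p ^ e) * g i); last by rewrite hx hy mulr0 addr0.
  rewrite mulr_sumr -big_split; apply: eq_bigr => i _.
  by rewrite !mxE frobeniusD // mulrDl exprMn mulrA.
(* y B = 0 says that the row y respects every generating relation, as values on the g_i must; v
   holds the values of E. *)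
pose B := \matrix_(i, j) R j i ^+ (p ^ e).
pose v := \row_i E (iota (g i)).
have [|t [K [w [KB vw]]]] := @completion_flat S J noethS m r B v.
  apply/rowP => j; rewrite !mxE; transitivity (E (iota 0)); last by rewrite !raddf0.
  have Rj : rel (row j R) by apply/RP; apply: row_span_row.
  rewrite -Rj frobenius_linear_sum //; apply: eq_bigr => i _.
  by rewrite !mxE mulrC.
have val l :
    exists2 d : diffop phi, frobenius_linear p e d & forall i, d (g i) = K l i.
  apply: diffop_of_values => // c hc.
  have [|b cb] := (RP (\row_i c i)).1.
    by rewrite /rel -[RHS]hc; apply: eq_bigr => i _; rewrite mxE.
  (* Since c = b R, any relation reduces to the generating ones, which K B = 0 settles. *)
  have -> : \sum_i c i ^+ (p ^ e) * K l i = \sum_j b 0 j ^+ (p ^ e) * (K *m B) l j.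
    under eq_bigr => i _.
      have -> : c i = \sum_j b 0 j * R j i.
        by have := congr1 (fun x : 'rV_m => x 0 i) cb; rewrite !mxE.
      rewrite frobenius_sum // mulr_suml; over.
    rewrite exchange_big; apply: eq_bigr => j _; rewrite mxE mulr_sumr.
    by apply: eq_bigr => i _; rewrite mxE exprMn -mulrA [K l i * _]mulrC.
  by rewrite KB big1 // => j _; rewrite mxE mulr0.
pose d l := s2val (cid2 (val l)).
have dL l : frobenius_linear p e (d l) by rewrite /d; case: cid2.
have dK l i : d l (g i) = K l i by rewrite /d; case: cid2.
(* Its image agrees with E on the g_i because v = w K; q-power linearity extends this to S, and
   density to the completion. *)
exists (\sum_l ctens (w 0 l) (d l)); rewrite raddf_sum.
rewrite (eq_bigr _ (fun l _ => natural_mapE (w 0 l) (d l))).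
apply: diffop_dense => // s; have [c ->] := gP s.
rewrite (frobenius_linear_sum _ _ hE) diffop_sumE.
have extE l x : (w 0 l *: diffop_ext J (d l)) (iota x) = w 0 l * iota (d l x).
  by rewrite -diffop_ext_of.
under eq_bigr => l _ do rewrite extE.
have vE i : E (iota (g i)) = \sum_l w 0 l * iota (K l i).
  have := congr1 (fun x : 'rV_m => x 0 i) vw; rewrite !mxE => ->.
  by apply: eq_bigr => l _; rewrite mxE.
under [RHS]eq_bigr => i _ do rewrite vE mulr_sumr.
rewrite exchange_big; apply: eq_bigr => l _.
rewrite !raddf_sum mulr_sumr; apply: eq_bigr => i _ /=.
by rewrite dL dK rmorphM mulrCA.
Qed.

Lemma completed_tensor_sum (t : completed_tensor phi J) :
  exists n (u : 'I_n -> completion J) (d : 'I_n -> diffop phi),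
    t = \sum_i ctens (u i) (d i).
Proof.
suff [r ->] : exists r : seq (completion J * diffop phi),
    t = \sum_(x <- r) ctens x.1 x.2.
  rewrite big_tnth; exists (size r), (fun i => (tnth (in_tuple r) i).1).
  by exists (fun i => (tnth (in_tuple r) i).2).
elim/tensor_ind: t => [u d|x y [r ->] [s ->]].
  by exists [:: (u, d)]; rewrite big_seq1.
exists (r ++ [seq (- x.1, x.2) | x <- s]); rewrite big_cat big_map -sumrN.
by congr (_ + _); apply: eq_bigr => -[u d] _; rewrite /= /ctens tensNl.
Qed.

(** If sum_i u_i d_i vanishes, then u B = 0 for B = (d_i(g_j)). Flatness gives u = w K with K B = 0;
    each sum_i K_li d_i kills the g_j, hence is zero by q-power linearity, and moving K across the
    tensor sign gives t = 0. *)
Lemma natural_map_ker (t : completed_tensor phi J) : nat_map t = 0 -> t = 0.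
Proof.
have [m [u [d ->]]] := completed_tensor_sum t.
rewrite raddf_sum; rewrite (eq_bigr _ (fun i _ => natural_mapE (u i) (d i))).
move=> sum0.
have [e [n [g [le_e gP]]]] :=
  F_finite_span p_prime p0 (\max_i diffop_order (d i)) FfinS.
have dL i : frobenius_linear p e (d i).
  apply: frobenius_linear_le (diffop_le_frobenius p0 (diffop_orderP (d i))).
  by apply: leq_trans le_e; apply: (bigmax_sup i).
pose B := \matrix_(i, j) d i (g j).
have [|t' [K [w [KB uw]]]] := @completion_flat S J noethS m n B (\row_i u i).
  apply/rowP => j; rewrite !mxE.
  have := congr1 (fun E : diffop psi => E (iota (g j))) sum0.
  rewrite diffop_sumE => h; rewrite -[RHS]h; apply: eq_bigr => i _.
  by rewrite !mxE -diffop_ext_of.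
have Kd l : \sum_i K l i *: d i = 0.
  apply: diffopP => x; have [c ->] := gP x.
  rewrite raddf_sum big1 // => j _ /=; rewrite diffop_sumE.
  under eq_bigr => i _ do rewrite /= dL mulrCA.
  rewrite -mulr_sumr; have := congr1 (fun M : 'M_(t', n) => M l j) KB.
  rewrite !mxE; under eq_bigr => i _ do rewrite mxE.
  by move=> ->; rewrite mulr0.
have uE i : u i = \sum_l K l i *: w 0 l.
  have := congr1 (fun x : 'rV_m => x 0 i) uw; rewrite !mxE => ->.
  by apply: eq_bigr => l _; rewrite mxE mulrC.
transitivity (\sum_l ctens (w 0 l) (\sum_i K l i *: d i)).
  under eq_bigr => i _ do rewrite uE /ctens tens_suml.
  rewrite exchange_big; apply: eq_bigr => l _; rewrite /ctens tens_sumr.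
  by apply: eq_bigr => i _; rewrite tensZ.
by rewrite big1 // => l _; rewrite Kd /ctens tens0r.
Qed.

End NaturalMapBijective.

(** * The ring structure *)

Section TensorMul.
Variables (A S : comPzRingType) (phi : {rmorphism A -> S}) (J : submodClosed S^o).

Local Notation T := (completed_tensor phi J).

Lemma tensor_mulBl (mul : T -> T -> T) x y z :
  is_tensor_mul mul -> mul (x - y) z = mul x z - mul y z.
Proof. by move=> hm; apply/(canRL (addrK _)); rewrite -(tensor_mulDl hm) subrK. Qed.

Lemma tensor_mulBr (mul : T -> T -> T) x y z :
  is_tensor_mul mul -> mul x (y - z) = mul x y - mul x z.
Proof. by move=> hm; apply/(canRL (addrK _)); rewrite -(tensor_mulDr hm) subrK. Qed.

Lemma ctens_ind (P : T -> Prop) :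
  (forall u d, P (ctens u d)) -> (forall x y, P x -> P y -> P (x - y)) ->
  forall x, P x.
Proof. exact: tensor_ind. Qed.

Lemma ctens_mul (mul : T -> T -> T) u d :
  is_tensor_mul mul -> ctens u d = mul (ctens u 1) (ctens 1 d).
Proof. by move=> hm; rewrite (tensor_mul_completion hm) mulr1. Qed.

(** Since u (x) d is the product of u (x) 1 and 1 (x) d, associativity reduces every product to
    prescribed ones and to those of 1 (x) d with u (x) 1. *)
Lemma tensor_mul_ext (mul mul' : T -> T -> T) :
    is_tensor_mul mul -> is_tensor_mul mul' ->
    (forall d u, mul' (ctens 1 d) (ctens u 1) = mul (ctens 1 d) (ctens u 1)) ->
  forall x y, mul' x y = mul x y.
Proof.
move=> hm hm' comm.
have eql u x : mul' (ctens u 1) x = mul (ctens u 1) x.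
  elim/ctens_ind: x => [v d|x y hx hy]; last by rewrite !tensor_mulBr // hx hy.
  by rewrite !tensor_mul_completion.
have right (m : T -> T -> T) (hmm : is_tensor_mul m) u d e :
    m (ctens u d) (ctens 1 e) = m (ctens u 1) (ctens 1 (d * e)).
  by rewrite (ctens_mul u d hmm) -(tensor_mulA hmm) (tensor_mul_diffop hmm).
have eqr x e : mul' x (ctens 1 e) = mul x (ctens 1 e).
  elim/ctens_ind: x => [u d|x y hx hy]; last by rewrite !tensor_mulBl // hx hy.
  by rewrite (right _ hm') (right _ hm) eql.
have eq1 d y : mul' (ctens 1 d) y = mul (ctens 1 d) y.
  elim/ctens_ind: y => [v e|y z hy hz]; last by rewrite !tensor_mulBr // hy hz.
  rewrite [in LHS](ctens_mul v e hm') [in RHS](ctens_mul v e hm).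
  by rewrite (tensor_mulA hm) (tensor_mulA hm') comm eqr.
move=> x y; elim/ctens_ind: x => [u d|x z hx hz]; last first.
  by rewrite !tensor_mulBl // hx hz.
rewrite [in LHS](ctens_mul u d hm') [in RHS](ctens_mul u d hm).
by rewrite -(tensor_mulA hm) -(tensor_mulA hm') eq1 eql.
Qed.

End TensorMul.

(** * Transport of the product along the bijection, and its uniqueness *)

Theorem proposition2p11 (p : nat) (A : comNzRingType) (S : comPzRingType)
    (phi : {rmorphism A -> S}) (J : submodClosed S^o)
    (charA : p \in [pchar A])
    (perfectA : forall a : A, exists b : A, a = b ^+ p)
    (noethS : noetherian S) (FfinS : F_finite p S) :
  exists mul : completed_tensor phi J -> completed_tensor phi J ->
               completed_tensor phi J,
    [/\ is_tensor_mul mul,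
        forall mul', is_tensor_mul mul' ->
          forall x y, mul' x y = mul x y,
        {morph @natural_map A S phi J : x y / x + y >-> x + y},
        {morph @natural_map A S phi J : x y / mul x y >-> x * y} &
        @natural_map A S phi J (ctens 1 1) = 1 /\
        bijective (@natural_map A S phi J)].
Proof.
have p_prime : prime p by case/andP: charA.
have p0 : p%:R = 0 :> S.
  by rewrite -(rmorph_nat phi); case/andP: charA => _ /eqP ->; rewrite rmorph0.
pose T := completed_tensor phi J.
pose nu : T -> diffop (completion_alg phi J) := @natural_map A S phi J.
have nuE u d : nu (ctens u d) = u *: diffop_ext J d by apply: natural_mapE.
have nuB x y : nu (x - y) = nu x - nu y by apply: raddfB.
have surj E : exists t, nu t = E by apply: (natural_map_surj p_prime).
pose inv E := sval (cid (surj E)).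
have invK : cancel inv nu by move=> E; rewrite /inv; case: cid.
have nuI : injective nu.
  move=> x y xy; apply/eqP; rewrite -subr_eq0; apply/eqP.
  apply: (natural_map_ker p_prime p0 noethS FfinS).
  by rewrite -[LHS]/(nu _) nuB xy subrr.
pose mul x y := inv (nu x * nu y).
have nuM x y : nu (mul x y) = nu x * nu y by apply: invK.
have nuD x y : nu (x + y) = nu x + nu y by apply: raddfD.
have nu1 : nu (ctens 1 1) = 1 by rewrite nuE diffop_ext1 // scale1r.
have nuZ a t : nu (a *: t) = completion_of a *: nu t by apply: natural_mapZ.
have nu_sum (I : Type) (r : seq I) (f : I -> T) :
    nu (\sum_(i <- r) f i) = \sum_(i <- r) nu (f i).
  exact: (raddf_sum (@natural_map A S phi J)).
(* [nu] matches J^k T with J^k D(S^), so continuity can be tested on either side. *)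
have nu_pow k t : diffop_pow k (nu t) <-> ideal_pow_smul J k t.
  split=> [[r hr rE]|[r hr ->]].
    exists [seq (am.1, inv am.2) | am <- r].
      by move=> am /mapP[bn /hr h ->].
    apply: nuI; rewrite rE big_map nu_sum.
    by apply: eq_bigr => am _; rewrite nuZ invK.
  exists [seq (am.1, nu am.2) | am <- r].
    by move=> am /mapP[bn /hr h ->].
  rewrite big_map nu_sum.
  by apply: eq_bigr => am _; rewrite nuZ.
have hmul : is_tensor_mul mul.
  split.
  - by move=> x y z; apply: nuI; rewrite !nuM mulrA.
  - by move=> x; apply: nuI; rewrite nuM nu1 mul1r.
  - by move=> x; apply: nuI; rewrite nuM nu1 mulr1.
  - by move=> x y z; apply: nuI; rewrite !(nuM, nuD) mulrDl.
  - by move=> x y z; apply: nuI; rewrite !(nuM, nuD) mulrDr.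
  - move=> u v d; apply: nuI; rewrite nuM !nuE diffop_ext1 //.
    by apply: diffopP => x; rewrite /= mulrA.
  - by move=> d e; apply: nuI; rewrite nuM !nuE !scale1r diffop_extM.
  move=> d k; have [n hd] := diffop_proof (diffop_ext J d).
  exists (k + n)%N => u hu; apply/nu_pow.
  rewrite nuM !nuE scale1r diffop_ext1 //; exact: diffop_pow_smul hd hu.
exists mul; split=> //; last by split=> //; exists inv => // t; apply/nuI/invK.
move=> mul' hmul'; apply: tensor_mul_ext => // d u.
apply: nuI; apply/eqP; rewrite -subr_eq0 -nuB; apply/eqP.
apply: diffop_pow_eq0 => k.
have [m hm] := tensor_mul_continuous hmul d k.
have [m' hm'] := tensor_mul_continuous hmul' d k.
(* The level suits the continuity moduli of both products. *)
pose s := repr (u (maxn m m')).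
have hs : residue_of (maxn m m') s = u (maxn m m') by apply: residue_ofK.
pose v := u - completion_of s.
have hv l : (l <= maxn m m')%N -> ideal_pow_smul J l v.
  by move=> le_l; apply: coord_eq0_smul => //=; rewrite (coord_repr le_l hs) subrr.
(* The part of u coming from S gives 1 (x) (d * s) for both products and cancels; the parts coming
   from v lie in J^k T. *)
have uE : ctens u 1 = ctens v 1 + ctens 1 (s *: (1 : diffop phi)) :> T.
  rewrite /ctens -tensZ -tensDl; congr tens.
  by rewrite completion_scaleE mulr1 subrK.
rewrite uE (tensor_mulDr hmul) (tensor_mulDr hmul') (tensor_mul_diffop hmul).
rewrite (tensor_mul_diffop hmul') opprD addrACA subrr addr0 nuB.
apply: diffop_powB; apply/nu_pow.
  by apply/hm'/hv/leq_maxr.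
by apply/hm/hv/leq_maxl.
Qed.
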